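(* Let $\mathbf{X}$ and $\mathbf{Y}$ be stochastic processes with sample paths in $\mathbb{D}=\mathbb{D}([0,1],\mathbb{R}^d)$, defined on the same probability space. Suppose that $\mathbf{X}\in\mathrm{RV}((a_n),m,\overline{\mathbb{D}}_0)$ and that for every $\varepsilon>0$ $$\lim_{u\to\infty}\mathrm{P}(d^\circ(u^{-1}\mathbf{X},u^{-1}\mathbf{Y})>\varepsilon\mid|\mathbf{Y}|_\infty>u)=0\quad\text{and}\quad\lim_{u\to\infty}\mathrm{P}(d^\circ(u^{-1}\mathbf{X},u^{-1}\mathbf{Y})>\varepsilon\mid|\mathbf{X}|_\infty>u)=0.$$ Then $\mathbf{Y}\in\mathrm{RV}((a_n),m,\overline{\mathbb{D}}_0)$.
   Context: $|\cdot|$ is the Euclidean norm and $|\mathbf{x}|_\infty=\sup_{t\in[0,1]}|\mathbf{x}_t|$. $\mathbb{D}$ is the space of càdlàg functions $[0,1]\to\mathbb{R}^d$ with Billingsley's complete $J_1$-metric $d^\circ(\mathbf{x},\mathbf{y})=\inf_\lambda\max\{\sup_{s<t}|\log\frac{\lambda(t)-\lambda(s)}{t-s}|,\ \sup_t|\mathbf{x}_t-\mathbf{y}_{\lambda(t)}|\}$, the infimum being over increasing bijections $\lambda$ of $[0,1]$. Let $\mathbb{S}_\mathbb{D}=\{\mathbf{x}\in\mathbb{D}:|\mathbf{x}|_\infty=1\}$ and $\overline{\mathbb{D}}_0=(0,\infty]\times\mathbb{S}_\mathbb{D}$ with metric $\max\{|1/x^*-1/y^*|,d^\circ(\widetilde{\mathbf{x}},\widetilde{\mathbf{y}})\}$;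 $\mathbb{D}\setminus\{\mathbf{0}\}$ is identified with $(0,\infty)\times\mathbb{S}_\mathbb{D}$ via $\mathbf{x}\mapsto(|\mathbf{x}|_\infty,\mathbf{x}/|\mathbf{x}|_\infty)$, so that bounded subsets of $\overline{\mathbb{D}}_0$ are those on which $|\mathbf{x}|_\infty$ is bounded away from $0$. Measures $m_n$, finite on bounded sets, satisfy $m_n\xrightarrow{\hat w}m$ if $m_n(B)\to m(B)$ for every bounded Borel set $B$ with $m(\partial B)=0$. $\mathbf{X}\in\mathrm{RV}((a_n),m,\overline{\mathbb{D}}_0)$ means: $\mathbf{X}$ is a process with sample paths in $\mathbb{D}$, $0<a_n\uparrow\infty$, $m$ is a nonzero measure on $\mathcal{B}(\overline{\mathbb{D}}_0)$, finite on bounded sets, with $m(\overline{\mathbb{D}}_0\setminus\mathbb{D})=0$, and $n\mathrm{P}(a_n^{-1}\mathbf{X}\in\cdot)\xrightarrow{\hat w}m(\cdot)$ on $\mathcal{B}(\overline{\mathbb{D}}_0)$. It is known that then $m(u\cdot)=u^{-\alpha}m(\cdot)$ for all $u>0$ for some $\alpha>0$. *)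

(* Defs.v *)
From HB Require Import structures.
From mathcomp Require Import all_boot all_order all_algebra.
From mathcomp Require Import all_classical all_reals all_analysis.
From mathcomp Require Import ring lra.

Set Implicit Arguments.
Unset Strict Implicit.
Unset Printing Implicit Defensive.

Import Order.TTheory GRing.Theory Num.Theory.
Import numFieldNormedType.Exports.

Local Open Scope classical_set_scope.
Local Open Scope ring_scope.

(* The library norm on 'rV[R]_n is the sup norm, hence this definition; both
   norms induce the same topology. *)
Definition enorm (R : realType) (n : nat) (v : 'rV[R]_n) : R :=
  Num.sqrt (\sum_(i < n) v ord0 i ^+ 2).

Section enorm_theory.
Context (R : realType) (n : nat).
Implicit Types u v : 'rV[R]_n.

Lemma enorm_ge0 v : 0 <= enorm v. Proof. exact: sqrtr_ge0. Qed.

Lemma enorm_sqr v : enorm v ^+ 2 = \sum_(i < n) v ord0 i ^+ 2.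
Proof. by rewrite sqr_sqrtr// sumr_ge0// => i _; exact: sqr_ge0. Qed.

Lemma enorm0 : enorm (0 : 'rV[R]_n) = 0.
Proof. by rewrite /enorm big1 ?sqrtr0// => i _; rewrite mxE expr0n. Qed.

Lemma enormN v : enorm (- v) = enorm v.
Proof. by congr Num.sqrt; apply: eq_bigr => i _; rewrite mxE sqrrN. Qed.

Lemma coord_le_enorm v i : `|v ord0 i| <= enorm v.
Proof.
rewrite -(@ler_pXn2r _ 2)// ?nnegrE ?enorm_ge0// enorm_sqr real_normK ?num_real//.
by rewrite (bigD1 i)//= lerDl sumr_ge0// => j _; exact: sqr_ge0.
Qed.

Lemma norm_le_enorm v : `|v| <= enorm v.
Proof.
rewrite [leLHS]mx_normrE; apply: bigmax_le => [|[i j] _ /=]; first exact: enorm_ge0.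
by rewrite ord1 coord_le_enorm.
Qed.

Lemma enorm_dot u v :
  \sum_(i < n) u ord0 i * v ord0 i <= enorm u * enorm v.
Proof.
have := enorm_ge0 u; rewrite le_eqVlt => /predU1P[u0|u0].
  rewrite -u0 mul0r big1// => i _.
  by have := coord_le_enorm u i; rewrite -u0 normr_le0 => /eqP ->; rewrite mul0r.
have := enorm_ge0 v; rewrite le_eqVlt => /predU1P[v0|v0].
  rewrite -v0 mulr0 big1// => i _.
  by have := coord_le_enorm v i; rewrite -v0 normr_le0 => /eqP ->; rewrite mulr0.
have uv0 : 0 < 2 * (enorm u * enorm v) by rewrite !mulr_gt0.
rewrite -(ler_pM2l uv0) mulr_sumr.
have -> : 2 * (enorm u * enorm v) * (enorm u * enorm v) =
    \sum_(i < n) (enorm v ^+ 2 * u ord0 i ^+ 2 + enorm u ^+ 2 * v ord0 i ^+ 2).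
  by rewrite big_split/= -!mulr_sumr -!enorm_sqr; ring.
apply: ler_sum => i _; rewrite -subr_ge0.
rewrite [leRHS](_ : _ = (enorm v * u ord0 i - enorm u * v ord0 i) ^+ 2).
  exact: sqr_ge0.
ring.
Qed.

Lemma enormD u v : enorm (u + v) <= enorm u + enorm v.
Proof.
rewrite -(@ler_pXn2r _ 2)// ?nnegrE ?enorm_ge0 ?addr_ge0 ?enorm_ge0//.
rewrite sqrrD enorm_sqr.
have -> : \sum_(i < n) (u + v) ord0 i ^+ 2 =
    enorm u ^+ 2 + (\sum_(i < n) u ord0 i * v ord0 i) *+ 2 + enorm v ^+ 2.
  rewrite !enorm_sqr -sumrMnl -!big_split/=.
  by apply: eq_bigr => i _; rewrite mxE sqrrD.
by rewrite lerD2r lerD2l lerMn2r/= enorm_dot.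
Qed.

Lemma enorm_le_norm v : enorm v <= n%:R * `|v|.
Proof.
have le_v i : `|v ord0 i| <= `|v|.
  rewrite [leRHS]mx_normrE.
  by apply: (le_trans _ (le_bigmax _ (fun ij => `|v ij.1 ij.2|) (ord0, i))).
have s0 : 0 <= \sum_(i < n) `|v ord0 i| by exact: sumr_ge0.
apply: (@le_trans _ _ (\sum_(i < n) `|v ord0 i|)); last first.
  apply: (le_trans (ler_sum _ (fun i _ => le_v i))).
  by rewrite sumr_const card_ord mulr_natl.
rewrite -(@ler_pXn2r _ 2)// ?nnegrE ?enorm_ge0// enorm_sqr.
rewrite [leRHS]expr2 mulr_suml; apply: ler_sum => i _.
rewrite -real_normK ?num_real// expr2 ler_wpM2l//.
by rewrite (bigD1 i)//= lerDl sumr_ge0.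
Qed.

End enorm_theory.

Notation unit_interval R := (set_type [set` `[0%R : (R : realType), 1%R]]).

Section cadlag_paths.
Context (R : realType) (d : nat).
Local Notation I := (unit_interval R).
Local Notation V := 'rV[R]_d.+1.

(* At t = 1 (resp. t = 0) the first (resp. second) filter is improper and the
   requirement is void. *)
Definition cadlag (x : I -> V) : Prop :=
  forall t : I,
    x @ within (fun s : I => val t < val s) (nbhs t) --> x t /\
    exists l : V, x @ within (fun s : I => val s < val t) (nbhs t) --> l.

(* D([0,1], R^(d+1)); the dimension is a successor so that it is positive. *)
Record skorokhod := Skorokhod { path :> I -> V ; cadlag_path : cadlag path }.

HB.instance Definition _ := gen_eqMixin skorokhod.
HB.instance Definition _ := gen_choiceMixin skorokhod.

Definition supnorm (x : skorokhod) : R := sup (range (fun t => enorm (x t))).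

Lemma cadlag_cst (v : V) : cadlag (fun=> v).
Proof. by move=> t; split; [|exists v]; exact: cvg_cst. Qed.

Lemma cadlag_scale (c : R) (x : skorokhod) : cadlag (fun t => c *: x t).
Proof.
move=> t; have [xr [l xl]] := cadlag_path x t.
by split; [|exists (c *: l)]; apply: cvgZl_tmp.
Qed.

Definition skcst (v : V) : skorokhod := Skorokhod (cadlag_cst v).
Definition skscale (c : R) (x : skorokhod) : skorokhod :=
  Skorokhod (@cadlag_scale c x).

Definition time_change (l : I -> I) : Prop :=
  bijective l /\ forall s t : I, val s < val t -> val (l s) < val (l t).

Definition log_slope (l : I -> I) : \bar R :=
  ereal_sup [set `|ln ((val (l st.2) - val (l st.1)) /
                       (val st.2 - val st.1))|%:E
            | st in [set st : I * I | val st.1 < val st.2]].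

Definition path_dist (x y : skorokhod) (l : I -> I) : \bar R :=
  ereal_sup (range (fun t => (enorm (x t - y (l t)))%:E)).

Definition J1_dist_ereal (x y : skorokhod) : \bar R :=
  ereal_inf [set maxe (log_slope l) (path_dist x y l) | l in time_change].

(* The infimum is finite, since cadlag paths are bounded. *)
Definition J1_dist (x y : skorokhod) : R := fine (J1_dist_ereal x y).

End cadlag_paths.

Section J1_metric.
Context (R : realType) (d : nat).
Local Notation I := (unit_interval R).
Local Notation V := 'rV[R]_d.+1.
Implicit Types x y z : skorokhod R d.

Lemma cadlag_bounded x : exists M, forall t, enorm (x t) <= M.
Proof.
have [M HM] : exists M : R, forall t, `|x t| <= M; last first.
  exists (d.+1%:R * M) => t; apply: (le_trans (enorm_le_norm _)).
  by rewrite ler_wpM2l.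
pose P (M : R) (s : R) :=
  forall h : s \in ([set` `[0%R : R, 1%R]] : set R), `|x (exist _ s h)| <= M.
have cI := @segment_compact R 0 1.
move/compact_near_coveringP/near_covering_withinP : cI.
move=> /(_ R (+oo%R : set_system R) P _) [].
  move=> s sI; pose t : I := exist _ s (mem_set sI).
  have [xr [l xl]] := cadlag_path x t.
  pose M := `|x t| + `|l| + 1.
  have [e /= e0 re] : exists2 e : R, 0 < e & forall u : I,
      ball (val t) e (val u) -> `|x u| <= M.
    have Hr : \forall u \near within (fun u : I => val t < val u) (nbhs t),
        `|x u| <= M.
      by apply: cvgr_norm_le xr _ _; rewrite /M -addrA ltrDl ltr_wpDl.
    have Hl : \forall u \near within (fun u : I => val u < val t) (nbhs t),
        `|x u| <= M.
      by apply: cvgr_norm_le xl _ _; rewrite /M addrAC ltrDr ltr_wpDl.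
    have : nbhs t [set u : I | `|x u| <= M].
      move: Hr Hl; rewrite /within /= => Hr Hl.
      near=> u; have [ut|tu|ut] := ltgtP (val u) (val t).
      - by move: ut; near: u.
      - by move: tu; near: u.
      - have -> : u = t by exact: val_inj.
        by rewrite /M/= -addrA lerDl addr_ge0.
    by move=> /nbhs_ballP[e /= e0 He]; exists e => // u /He.
  exists (ball s e, [set N | M <= N]).
    split => /=; first exact: nbhsx_ballx.
    by apply: nbhs_pinfty_ge; rewrite num_real.
  move=> [u N] /= [bu MN] uI h; apply: le_trans MN; exact: re.
move=> M [_ HM]; exists (M + 1) => t.
have := HM (M + 1); rewrite ltrDl ltr01 => /(_ isT (val t)).
case: t => s h /=; apply; exact: set_mem h.
Unshelve. all: by end_near.
Qed.

Lemma unit_intervalP (t : I) : 0 <= val t <= 1.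
Proof. by case: t => t /= /set_mem; rewrite /= in_itv. Qed.

Lemma unit_interval_ex (r : R) : 0 <= r <= 1 -> exists t : I, val t = r.
Proof.
move=> r01; have h : r \in ([set` `[0%R : R, 1%R]] : set R).
  by apply/mem_set; rewrite /= in_itv.
by exists (exist _ r h).
Qed.

Lemma time_change_id : time_change (@id I).
Proof. by split => //; exists id. Qed.

Lemma time_change_comp (l k : I -> I) :
  time_change l -> time_change k -> time_change (k \o l).
Proof.
move=> [bl hl] [bk hk]; split; first exact: bij_comp.
by move=> s t st /=; exact/hk/hl.
Qed.

Lemma time_change_inv (l k : I -> I) :
  cancel l k -> cancel k l -> time_change l -> time_change k.
Proof.
move=> lk kl [_ hl]; split; first by exists l.
move=> s t st; rewrite ltNge; apply/negP; rewrite le_eqVlt => /orP[/eqP|] ts.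
  by move/val_inj : ts => /(congr1 l); rewrite !kl => ts; rewrite ts ltxx in st.
by move/hl : ts; rewrite !kl => /lt_trans /(_ st); rewrite ltxx.
Qed.

Lemma time_change_le (l : I -> I) (s t : I) :
  time_change l -> val s <= val t -> val (l s) <= val (l t).
Proof.
move=> [_ hl]; rewrite le_eqVlt => /predU1P[/val_inj->//|/hl/ltW//].
Qed.

Lemma time_change0 (l : I -> I) (t : I) :
  time_change l -> val t = 0 -> val (l t) = 0.
Proof.
move=> tl t0; have [[k lk kl] _] := tl.
apply/eqP; rewrite eq_le; have /andP[-> _] := unit_intervalP (l t).
rewrite andbT -[leRHS]t0 -[in leRHS](kl t); apply: time_change_le => //.
by rewrite t0; have /andP[] := unit_intervalP (k t).
Qed.

Lemma time_change1 (l : I -> I) (t : I) :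
  time_change l -> val t = 1 -> val (l t) = 1.
Proof.
move=> tl t1; have [[k lk kl] _] := tl.
apply/eqP; rewrite eq_le; have /andP[_ ->] := unit_intervalP (l t) => /=.
rewrite -[leLHS]t1 -[in leLHS](kl t); apply: time_change_le => //.
by rewrite t1; have /andP[] := unit_intervalP (k t).
Qed.

Lemma time_change_slope_gt0 (l : I -> I) (s t : I) : time_change l ->
  val s < val t -> 0 < (val (l t) - val (l s)) / (val t - val s).
Proof. by move=> [_ hl] st; rewrite divr_gt0// subr_gt0//; exact: hl. Qed.

Definition J1_le (e : R) x y (l : I -> I) := [/\ time_change l,
  forall s t : I, val s < val t ->
    `|ln ((val (l t) - val (l s)) / (val t - val s))| <= e &
  forall t, enorm (x t - y (l t)) <= e].

Lemma J1_leP e x y (l : I -> I) : J1_le e x y l <->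
  time_change l /\ (maxe (log_slope l) (path_dist x y l) <= e%:E)%E.
Proof.
rewrite ge_max; split.
  move=> [tl hl hx]; split => //; apply/andP; split; apply: ge_ereal_sup.
    by move=> _ [[s t]/= st <-]; rewrite lee_fin hl.
  by move=> _ [t _ <-]; rewrite lee_fin.
move=> [tl /andP[hl hx]]; split => //.
  move=> s t st; rewrite -lee_fin; apply: le_trans hl.
  by apply: ereal_sup_ubound; exists (s, t).
move=> t; rewrite -lee_fin; apply: le_trans hx.
by apply: ereal_sup_ubound; exists t.
Qed.

Lemma J1_dist_ereal_ge0 x y : (0 <= J1_dist_ereal x y)%E.
Proof.
apply: le_ereal_inf_tmp => _ [l tl <-]; rewrite le_max; apply/orP; right.
have [t _] : exists t : I, val t = 0 by apply: unit_interval_ex; rewrite lexx ler01.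
apply: le_trans (ereal_sup_ubound _); last by exists t.
by rewrite lee_fin enorm_ge0.
Qed.

Lemma J1_dist_ereal_le e x y l :
  J1_le e x y l -> (J1_dist_ereal x y <= e%:E)%E.
Proof.
move=> /J1_leP[tl h]; apply: ge_ereal_inf.
by exists (maxe (log_slope l) (path_dist x y l)) => //; exists l.
Qed.

Lemma J1_le_id x : J1_le 0 x x id.
Proof.
split => [|s t st|t]; first exact: time_change_id.
  by rewrite divff ?ln1 ?normr0// gt_eqF// subr_gt0.
by rewrite subrr enorm0.
Qed.

Lemma J1_dist_ereal_fin x y : J1_dist_ereal x y \is a fin_num.
Proof.
rewrite ge0_fin_numE ?J1_dist_ereal_ge0//.
have [M xM] := cadlag_bounded x; have [N yN] := cadlag_bounded y.
apply: (@le_lt_trans _ _ (M + N)%:E); last exact: ltry.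
apply: (@J1_dist_ereal_le _ _ _ id); split.
- exact: time_change_id.
- move=> s t st; rewrite divff ?ln1 ?normr0; last by rewrite gt_eqF// subr_gt0.
  by rewrite addr_ge0// (le_trans (enorm_ge0 _) (xM s), le_trans (enorm_ge0 _) (yN s)).
- by move=> t; rewrite (le_trans (enormD _ _))// enormN lerD.
Qed.

Lemma J1_dist_ge0 x y : 0 <= J1_dist x y.
Proof. exact/fine_ge0/J1_dist_ereal_ge0. Qed.

Lemma J1_dist_le e x y l : J1_le e x y l -> J1_dist x y <= e.
Proof.
by move=> /J1_dist_ereal_le; rewrite -(fineK (J1_dist_ereal_fin x y)) lee_fin.
Qed.

Lemma J1_dist_lt e x y : J1_dist x y < e -> exists l, J1_le e x y l.
Proof.
rewrite -lte_fin (fineK (J1_dist_ereal_fin x y)) => /ereal_inf_lt[_ [l tl <-] h].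
by exists l; apply/J1_leP; split => //; exact: ltW.
Qed.

Lemma J1_distxx x : J1_dist x x = 0.
Proof.
by apply/eqP; rewrite eq_le J1_dist_ge0 (J1_dist_le (J1_le_id x)).
Qed.

Lemma J1_dist_sym x y : J1_dist x y = J1_dist y x.
Proof.
suff h : forall u v : skorokhod R d, J1_dist u v <= J1_dist v u.
  by apply/eqP; rewrite eq_le !h.
move=> {x y} u v; apply/ler_addgt0Pr => e e0.
have /J1_dist_lt[l [tl hl hx]] : J1_dist v u < J1_dist v u + e by rewrite ltrDl.
have [[k lk kl] _] := tl.
have tk := time_change_inv lk kl tl.
apply: (@J1_dist_le _ _ _ k); split => // [s t st|t].
- have ks := proj2 tk _ _ st.
  have := hl _ _ ks; rewrite !kl -[X in ln X]invrK lnV ?normrN ?invf_div//.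
  by rewrite posrE; exact: time_change_slope_gt0.
- by have := hx (k t); rewrite kl -enormN opprB.
Qed.

Lemma J1_dist_triangle y x z : J1_dist x z <= J1_dist x y + J1_dist y z.
Proof.
apply/ler_addgt0Pr => e e0.
have /J1_dist_lt[l [tl hl hx]] : J1_dist x y < J1_dist x y + e / 2.
  by rewrite ltrDl divr_gt0.
have /J1_dist_lt[k [tk hk hy]] : J1_dist y z < J1_dist y z + e / 2.
  by rewrite ltrDl divr_gt0.
have -> : J1_dist x y + J1_dist y z + e =
    (J1_dist x y + e / 2) + (J1_dist y z + e / 2) by rewrite addrACA -splitr.
apply: (@J1_dist_le _ _ _ (k \o l)); split => [|s t st|t].
- exact: time_change_comp.
- have lst := proj2 tl _ _ st.
  rewrite (_ : _ / _ =
    ((val (l t) - val (l s)) / (val t - val s)) *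
    ((val (k (l t)) - val (k (l s))) / (val (l t) - val (l s)))); last first.
    by rewrite [RHS]mulrC mulrA divfK// gt_eqF// subr_gt0.
  rewrite lnM ?posrE ?time_change_slope_gt0//.
  by rewrite (le_trans (ler_normD _ _))// lerD ?hl ?hk.
- rewrite /= -(subrKA (y (l t))).
  by rewrite (le_trans (enormD _ _))// lerD.
Qed.

Lemma path_inj x y : path x = path y -> x = y.
Proof.
by case: x y => [x cx] [y cy] /= xy; subst y; congr Skorokhod; exact: Prop_irrelevance.
Qed.

Lemma J1_le_time (e : R) x y (l : I -> I) (t : I) : 0 < e -> J1_le e x y l ->
  `|val (l t) - val t| <= expR e - 1.
Proof.
move=> e0 [tl hl _].
have /andP[t0 t1] := unit_intervalP t.
move: t0; rewrite le_eqVlt => /predU1P[t0|t0].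
  rewrite (time_change0 tl (esym t0)) -t0 subrr normr0 subr_ge0.
  by rewrite -expR0 ler_expR ltW.
have [z z0] : exists z : I, val z = 0 by apply: unit_interval_ex; rewrite lexx ler01.
have zt : val z < val t by rewrite z0.
have := hl _ _ zt; have sg := time_change_slope_gt0 tl zt; move: sg.
rewrite (time_change0 tl z0) z0 !subr0 => sg.
rewrite ler_norml -ler_expR -[X in _ && X]ler_expR lnK ?posrE// => /andP[lo hi].
have -> : val (l t) - val t = (val (l t) / val t - 1) * val t.
  by rewrite mulrBl mul1r divfK// gt_eqF.
rewrite normrM (gtr0_norm t0).
have E1 : 1 <= expR e by rewrite -expR0 ler_expR ltW.
apply: (@le_trans _ _ `|val (l t) / val t - 1|); first by rewrite ler_piMr.
rewrite ler_norml lerD2r hi andbT opprB lerBrDr.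
apply: le_trans lo; rewrite expRN.
rewrite -subr_ge0.
have Eg : 0 < expR e by exact: expR_gt0.
rewrite (_ : _ - _ = (expR e - 1) ^+ 2 / expR e); first by rewrite divr_ge0 ?sqr_ge0// ltW.
by field; rewrite gt_eqF.
Qed.

Lemma J1_dist_positivity x y : J1_dist x y = 0 -> x = y.
Proof.
move=> xy0; apply: path_inj; apply/funext => t.
have xyl (e : R) : 0 < e -> exists l, J1_le e x y l.
  by move=> e0; apply: J1_dist_lt; rewrite xy0.
apply/eqP; rewrite -subr_eq0 -normr_le0; apply/ler_addgt0Pl => e e0.
rewrite addr0.
have /andP[_ t1] := unit_intervalP t.
move: t1; rewrite le_eqVlt => /predU1P[t1|t1].
  have [l [tl _ /(_ t)]] := xyl _ e0.
  have -> : l t = t by apply: val_inj; rewrite (time_change1 tl t1) t1.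
  exact/le_trans/norm_le_enorm.
have e30 : 0 < e / 3 by rewrite divr_gt0.
have [xr _] := cadlag_path x t; have [yr _] := cadlag_path y t.
have [r /= r0 hr] : exists2 r : R, 0 < r & forall u : I,
    ball (val t) r (val u) -> val t < val u ->
    `|x t - x u| <= e / 3 /\ `|y t - y u| <= e / 3.
  have Hx : \forall u \near within (fun u : I => val t < val u) (nbhs t),
      `|x t - x u| <= e / 3 by exact: (cvgr_dist_le _ _ xr).
  have Hy : \forall u \near within (fun u : I => val t < val u) (nbhs t),
      `|y t - y u| <= e / 3 by exact: (cvgr_dist_le _ _ yr).
  have : nbhs t [set u : I | val t < val u ->
      `|x t - x u| <= e / 3 /\ `|y t - y u| <= e / 3].
    by near=> u => /= tu; split; move: tu; near: u.
  by move=> /nbhs_ballP[r /= r0 hr]; exists r => // u /hr.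
pose s0 := Num.min ((val t + 1) / 2) (val t + r / 2).
have [ts0 s01 s0r] : [/\ val t < s0, s0 < 1 & s0 <= val t + r / 2].
  rewrite /s0; split.
  - by rewrite lt_min midf_lt//= ltrDl divr_gt0.
  - by rewrite gt_min midf_lt.
  - by rewrite ge_min lexx orbT.
have /andP[t0 _] := unit_intervalP t.
have [s ss0] : exists s : I, val s = s0.
  by apply: unit_interval_ex; rewrite (le_trans t0 (ltW ts0)) ltW.
have ts : val t < val s by rewrite ss0.
have st : val s <= val t + r / 2 by rewrite ss0.
pose c := Num.min (val s - val t) (r / 2).
have c0 : 0 < c by rewrite /c lt_min subr_gt0 ts divr_gt0.
pose f := Num.min (e / 3) (ln (1 + c / 2)).
have f0 : 0 < f by rewrite /f lt_min e30 ln_gt0// ltrDl divr_gt0.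
have [l le_l] := xyl _ f0.
have ls : `|val (l s) - val s| < c.
  apply: (le_lt_trans (J1_le_time _ f0 le_l)).
  rewrite ltrBlDr; apply: (@le_lt_trans _ _ (1 + c / 2)).
    rewrite -[leRHS]lnK ?posrE ?addr_gt0 ?divr_gt0// ler_expR.
    by rewrite /f ge_min lexx orbT.
  by rewrite addrC ltrD2r ltr_pdivrMr// ltr_pMr// ltr1n.
have [cst cr] : c <= val s - val t /\ c <= r / 2.
  by split; rewrite /c ge_min lexx ?orbT.
have tls : val t < val (l s).
  by move: ls; rewrite ltr_norml => /andP[+ _]; move: cst; lra.
have [xs _] : `|x t - x s| <= e / 3 /\ `|y t - y s| <= e / 3.
  apply: hr => //; rewrite /ball/= distrC ger0_norm; last by rewrite subr_ge0 ltW.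
  rewrite ltrBlDl (le_lt_trans st)// ltrD2l ltr_pdivrMr// ltr_pMr// ltr1n//.
have [_ ys] : `|x t - x (l s)| <= e / 3 /\ `|y t - y (l s)| <= e / 3.
  apply: hr => //; rewrite /ball/= distrC ger0_norm; last by rewrite subr_ge0 ltW.
  move: ls; rewrite ltr_norml => /andP[_]; rewrite ltrBlDr ltrBlDl => lsc.
  apply: (lt_le_trans lsc); apply: (le_trans (lerD cr st)).
  by rewrite addrCA -splitr.
have xys : `|x s - y (l s)| <= e / 3.
  have [_ _ /(_ s) h] := le_l; apply: (le_trans (norm_le_enorm _)).
  by apply: (le_trans h); rewrite /f ge_min lexx.
have -> : x t - y t = (x t - x s) + (x s - y (l s)) - (y t - y (l s)).
  by rewrite opprB subrKA subrKA.
rewrite (le_trans (ler_normB _ _))//.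
have := ler_normD (x t - x s) (x s - y (l s)).
by move: xs ys xys; lra.
Unshelve. all: by end_near. Qed.

End J1_metric.

HB.instance Definition _ (R : realType) (d : nat) :=
  @isMetric.Build R (skorokhod R d) (@J1_dist R d) (@J1_distxx R d)
    (@J1_dist_positivity R d) (@J1_dist_sym R d) (@J1_dist_triangle R d).

Section Dbar0_def.
Context (R : realType) (d : nat).

(* (0, +oo] times the unit sphere of D for the supremum norm. *)
Record Dbar0 := MkDbar0 {
  radius : \bar R ;
  angle : skorokhod R d ;
  radius_gt0 : (0 < radius)%E ;
  supnorm_angle : supnorm angle = 1 }.

HB.instance Definition _ := gen_eqMixin Dbar0.
HB.instance Definition _ := gen_choiceMixin Dbar0.

(* The inverse of extended reals satisfies +oo^-1 = 0. *)
Definition inv_radius (p : Dbar0) : R := fine (radius p)^-1%E.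

Definition Dbar0_dist (p q : Dbar0) : R :=
  Num.max `|inv_radius p - inv_radius q| (mdist (angle p) (angle q)).

Implicit Types p q : Dbar0.

Lemma Dbar0_distxx p : Dbar0_dist p p = 0.
Proof. by rewrite /Dbar0_dist subrr normr0 mdistxx maxxx. Qed.

Lemma inv_radius_inj p q : inv_radius p = inv_radius q -> radius p = radius q.
Proof.
rewrite /inv_radius; move: (radius_gt0 p) (radius_gt0 q).
case: (radius p) (radius q) => [r| |] [s| |]//=; rewrite ?lte_fin => r0 s0;
  rewrite ?inver ?gt_eqF//=.
- by move/invr_inj => ->.
- by move=> /eqP; rewrite invr_eq0 gt_eqF.
- by move=> /esym/eqP; rewrite invr_eq0 gt_eqF.
Qed.

Lemma Dbar0_dist_positivity p q : Dbar0_dist p q = 0 -> p = q.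
Proof.
move=> /eqP; rewrite eq_le ge_max => /andP[/andP[]].
rewrite normr_le0 subr_eq0 => /eqP/inv_radius_inj rpq pq _.
have apq : angle p = angle q.
  by apply: mdist_positivity; apply/eqP; rewrite eq_le pq mdist_ge0.
case: p q rpq apq {pq} => [r x r0 x1] [s y s0 y1] /= rs xy; subst s y.
by congr MkDbar0; exact: Prop_irrelevance.
Qed.

Lemma Dbar0_dist_sym p q : Dbar0_dist p q = Dbar0_dist q p.
Proof. by rewrite /Dbar0_dist distrC metric_sym. Qed.

Lemma Dbar0_dist_triangle q p r :
  Dbar0_dist p r <= Dbar0_dist p q + Dbar0_dist q r.
Proof.
rewrite ge_max; apply/andP; split.
  rewrite -(subrKA (inv_radius q)) (le_trans (ler_normD _ _))//.
  by rewrite lerD// le_max lexx.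
by rewrite (le_trans (metric_triangle _ (angle q) _))// lerD// le_max lexx orbT.
Qed.

Lemma supnorm_cst (v : 'rV[R]_d.+1) : supnorm (skcst v) = enorm v.
Proof.
rewrite /supnorm/=.
have [t _] := @unit_interval_ex R 0 (introT andP (conj (lexx _) ler01)).
rewrite (_ : range _ = [set enorm v]) ?sup1//.
by apply/seteqP; split => [_ [s _ <-]//|_ ->]; exists t.
Qed.

Lemma enorm_delta : enorm (delta_mx ord0 ord0 : 'rV[R]_d.+1) = 1.
Proof.
rewrite /enorm (bigD1 ord0)//= big1 ?mxE ?eqxx ?expr1n ?addr0 ?sqrtr1//.
by move=> i /negbTE i0; rewrite mxE i0 andbF expr0n.
Qed.

Definition Dbar0_point : Dbar0 := @MkDbar0 1%E _ lte01
  (etrans (supnorm_cst _) enorm_delta).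

End Dbar0_def.

HB.instance Definition _ (R : realType) (d : nat) :=
  @isMetric.Build R (Dbar0 R d) (@Dbar0_dist R d) (@Dbar0_distxx R d)
    (@Dbar0_dist_positivity R d) (@Dbar0_dist_sym R d)
    (@Dbar0_dist_triangle R d).
HB.instance Definition _ (R : realType) (d : nat) :=
  isPointed.Build (Dbar0 R d) (Dbar0_point R d).

Definition metric_bounded (R : realType) (T : metricType R) (A : set T) : Prop :=
  exists M : R, forall p q, A p -> A q -> mdist p q <= M.

Lemma metric_bounded_Dbar0P (R : realType) (d : nat) (A : set (Dbar0 R d)) :
  metric_bounded A <->
  exists2 r : R, 0 < r & forall p, A p -> (r%:E <= radius p)%E.
Proof.
have inv_ge0 (p : Dbar0 R d) : 0 <= inv_radius p.
  rewrite /inv_radius; have := radius_gt0 p; case: (radius p) => [s| |]//= s0.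
  by rewrite inver gt_eqF//= invr_ge0 ltW.
have invP (p : Dbar0 R d) (r : R) : 0 < r ->
    (r%:E <= radius p)%E = (inv_radius p <= r^-1).
  move=> r0; rewrite /inv_radius; have := radius_gt0 p.
  case: (radius p) => [s| |]//= s0; last by rewrite leey invr_ge0 ltW.
  by rewrite inver gt_eqF//= lef_pV2 ?posrE// lee_fin.
split.
  move=> [M AM]; have [[p Ap]|nA] := pselect (exists p, A p); last first.
    by exists 1 => // p Ap; case: nA; exists p.
  pose K := inv_radius p + `|M| + 1.
  have K0 : 0 < K by rewrite ltr_wpDl// addr_ge0.
  exists K^-1; first by rewrite invr_gt0.
  move=> q Aq; rewrite invP ?invr_gt0// invrK.
  have : `|inv_radius q - inv_radius p| <= M.
    by apply: le_trans (AM q p Aq Ap); rewrite /mdist/= le_max lexx.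
  rewrite /K; have := ler_norm (inv_radius q - inv_radius p).
  by have := ler_norm M; lra.
move=> [r r0 Ar]; exists (Num.max r^-1 2) => p q /Ar + /Ar.
rewrite !invP// => pr qr; rewrite /mdist/= /Dbar0_dist ge_max !le_max.
apply/andP; split; apply/orP; [left|right].
  rewrite ler_norml; apply/andP; split.
    by rewrite lerBrDl (le_trans _ (inv_ge0 p))// subr_le0.
  by rewrite lerBlDr (le_trans pr)// lerDl.
have sph (x : skorokhod R d) t : supnorm x = 1 -> enorm (x t) <= 1.
  move=> <-; apply: ub_le_sup; last by exists t.
  by have [M xM] := cadlag_bounded x; exists M => _ [s _ <-].
apply: (@J1_dist_le _ _ _ _ _ id); split.
- exact: time_change_id.
- by move=> s t st; rewrite divff ?ln1 ?normr0// gt_eqF// subr_gt0.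
- move=> t; rewrite (le_trans (enormD _ _))// enormN (_ : 2 = 1 + 1)//.
  by rewrite lerD// sph// supnorm_angle.
Qed.

Notation borel T := (g_sigma_algebraType (@open T)).

(* p is the image of x under x |-> (|x|_oo, x / |x|_oo); the null path has no
   image since radii are positive. *)
Definition polar_of (R : realType) (d : nat)
    (x : skorokhod R d) (p : Dbar0 R d) : Prop :=
  radius p = (supnorm x)%:E /\ angle p = skscale (supnorm x)^-1 x.

(* B seen as a set of paths, via the identification of the nonzero paths with
   the points of finite radius. *)
Definition paths_in (R : realType) (d : nat) (B : set (Dbar0 R d)) :
    set (skorokhod R d) :=
  [set x | exists2 p, B p & polar_of x p].

Definition hatw_cvg (R : realType) (d : nat)
    (mu : nat -> set (Dbar0 R d) -> \bar R)
    (m : {measure set (borel (Dbar0 R d)) -> \bar R}) : Prop :=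
  forall B : set (Dbar0 R d),
    measurable (B : set (borel (Dbar0 R d))) -> metric_bounded B ->
    m (closure B `\` interior B) = 0%E ->
    mu n B @[n --> \oo] --> m B.

Definition process (R : realType) (d : nat) (disp : measure_display)
    (Omega : measurableType disp) (X : Omega -> skorokhod R d) : Prop :=
  forall (t : unit_interval R) (i : 'I_d.+1),
    measurable_fun setT (fun w => X w t ord0 i).

(* a is indexed from 0 rather than from 1; a 0 plays no role in the limit. *)
Definition regularly_varying (R : realType) (d : nat) (disp : measure_display)
    (Omega : measurableType disp) (P : probability Omega R)
    (X : Omega -> skorokhod R d) (a : nat -> R)
    (m : {measure set (borel (Dbar0 R d)) -> \bar R}) : Prop :=
  process X /\
  [/\ forall n, 0 < a n, nondecreasing_seq a & a @ \oo --> +oo] /\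
  [/\ m setT <> 0%E,
      forall B : set (Dbar0 R d), measurable (B : set (borel (Dbar0 R d))) ->
        metric_bounded B -> (m B < +oo)%E &
      m [set p | radius p = +oo%E] = 0%E] /\
  hatw_cvg (fun n B =>
    (n%:R%:E * P [set w | paths_in B (skscale (a n)^-1 (X w))])%E) m.

(* P(A | B), equal to 0 when P(B) = 0. *)
Definition cond_proba (R : realType) (disp : measure_display)
    (Omega : measurableType disp) (P : probability Omega R)
    (A B : set Omega) : R :=
  fine (P (A `&` B)) / fine (P B).

(* Main.v *)
Require Import Defs.
From mathcomp Require Import all_boot all_order all_algebra.
From mathcomp Require Import all_classical all_reals all_analysis.
From mathcomp Require Import measurable_realfun ring lra.

(** Write [Xn] and [Yn] for the paths [X] and [Y] divided by [a n], and let [B] be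
    a bounded Borel set whose boundary is [m]-null. It suffices to show that
    n P(Xn in B) and n P(Yn in B) have the same limit, and for this to bound
    the symmetric difference of the two events.

    If exactly one of the two paths lies in [B], that path is bounded away from 0 in
    norm, say its norm exceeds [c]. Either [Xn] and [Yn] are then at distance more
    than some small [e], or they are close, hence close in polar coordinates too
    ([polar_unif]), and then [Xn] lies in [straddle r B], the set of points within [r]
    of both [B] and its complement ([count_paths_in_close]). As [r] tends to 0 these
    sets decrease to the boundary of [B], so their [m]-mass tends to 0, and [r] can be
    chosen so that they are continuity sets themselves ([straddle_small]); regular
    variation of [X] then makes n P(Xn in straddle r B) eventually small.

    For the event that the paths are apart, n P(d(Xn, Yn) > e, |Zn| > c) with Z = X or
    Z = Y is the product of a conditional probability, which tends to 0 by
    hypothesis, and of n P(|Zn| > c), so what is needed is that the latter stays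
    bounded ([apart_negligible]). For [X] this is regular variation
    ([regularly_varying_tight]); for [Y] the first hypothesis bounds P(|Y| > u) by
    2 P(|X| > u / 2) for large u ([tight_transfer]).

    All these estimates presuppose that the events are measurable, whereas a process
    is only measurable at each time. This is settled by approximating a cadlag path by
    step functions on a regular grid with rational values ([step_path_approx]). For a
    given mesh they form a countable family and the code of the approximation is a
    measurable function of the path, so every event defined by it is
    measurable; events open in the path are recovered in the limit
    ([limit_preimage_measurable]). The convergence in the Skorokhod metric rests on a
    time change carrying a finite set of partition points to grid points with slopes
    close to 1, obtained by adding to the identity a Lipschitz extension of the
    required displacements ([grid_time_change]). *)

Set Implicit Arguments.
Unset Strict Implicit.
Unset Printing Implicit Defensive.

Import Order.TTheory GRing.Theory Num.Theory.
Import numFieldNormedType.Exports.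

Local Open Scope classical_set_scope.
Local Open Scope ring_scope.

(** * Oscillation of cadlag paths *)

Section cadlag_oscillation.
Context (R : realType) (d : nat).
Local Notation I := (unit_interval R).
Implicit Types x : skorokhod R d.

(** The right limit at [t] is [x t] itself, so [t] belongs to the right-hand
    piece: the two sides of [t] are distinguished by the test [val t <= _]. *)
Lemma cadlag_local_osc x (t : I) (e : R) : 0 < e ->
  exists2 r : R, 0 < r & forall u v : I,
    `|val u - val t| <= r -> `|val v - val t| <= r ->
    (val t <= val u) = (val t <= val v) -> `|x u - x v| <= e.
Proof.
move=> e0; have [xr [l xl]] := cadlag_path x t.
have e20 : 0 < e / 2 by rewrite divr_gt0.
have Hr : \forall u \near within (fun s : I => val t < val s) (nbhs t),
  `|x t - x u| <= e / 2 by exact: (cvgr_dist_le _ _ xr).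
have Hl : \forall u \near within (fun s : I => val s < val t) (nbhs t),
  `|l - x u| <= e / 2 by exact: (cvgr_dist_le _ _ xl).
have : nbhs t [set u : I | (val t < val u -> `|x t - x u| <= e / 2) /\
                           (val u < val t -> `|l - x u| <= e / 2)].
  by near=> u => /=; split => tu; move: tu; near: u.
move=> /nbhs_ballP[r /= r0 hr]; exists (r / 2); first by rewrite divr_gt0.
have side (u : I) : `|val u - val t| <= r / 2 ->
    (val t <= val u -> `|x t - x u| <= e / 2) /\
    (val u < val t -> `|l - x u| <= e / 2).
  move=> ur; have /hr/=[ru lu] : ball t r u.
    have : `|val t - val u| < r; last by [].
    rewrite distrC; apply: (le_lt_trans ur).
    by rewrite ltr_pdivrMr// ltr_pMr// ltr1n.
  split => //; rewrite le_eqVlt => /predU1P[/val_inj <-|//].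
  by rewrite subrr normr0 ltW.
have tri (a b c : 'rV[R]_d.+1) :
    `|a - b| <= e / 2 -> `|a - c| <= e / 2 -> `|b - c| <= e.
  move=> ab ac; rewrite -(subrKA a) (splitr e) (le_trans (ler_normD _ _))//.
  by rewrite lerD// distrC.
move=> u v /side[ur ul] /side[vr vl] uv.
have [tu|ut] := leP (val t) (val u).
  by apply: tri (ur tu) (vr _); rewrite -uv.
by apply: tri (ul ut) (vl _); rewrite ltNge -uv -ltNge.
Unshelve. all: by end_near. Qed.

(** Billingsley's partition, with the intervals replaced by a symmetric condition:
    [u] and [v] lie in the same half-open piece when no point of [S] separates
    them. This form transports along monotone maps. The local oscillation bounds are patched together by
    compactness of [0, 1]: the centre and both ends of each covering interval
    are put into [S], so that a [v] not separated from [u] stays in the interval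
    around [u] and on the same side of its centre. *)
Lemma cadlag_partition x (e : R) : 0 < e ->
  exists S : seq R, [/\ 0 \in S, 1 \in S, (forall s, s \in S -> 0 <= s <= 1) &
    forall u v : I, (forall s, s \in S -> (s <= val u) = (s <= val v)) ->
      `|x u - x v| <= e].
Proof.
move=> e0.
have /choice[r hr] : forall t : R, exists r : R, 0 < r /\
    forall z : I, val z = t -> forall u v : I,
    `|val u - t| <= r -> `|val v - t| <= r ->
    (t <= val u) = (t <= val v) -> `|x u - x v| <= e.
  move=> t; have [t01|t01] := boolP (0 <= t <= 1); last first.
    by exists 1; split => // z zt; rewrite -zt unit_intervalP in t01.
  have [z zt] := unit_interval_ex t01.
  have [r r0 hr] := cadlag_local_osc x z e0.
  exists r; split => // z' z't; have -> : t = val z' by [].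
  by have -> : z' = z by apply: val_inj; rewrite z't.
have := @segment_compact R 0 1; rewrite compact_cover => /(_ R
  [set` `[0%R : R, 1%R]] (fun t => ball t (r t))) [].
- by move=> t _; exact: ball_open.
- by move=> t t01; exists t => //; apply: ballxx; have [] := hr t.
move=> D D01 Dcov.
pose S := 0 :: 1 :: [seq s <- flatten [seq [:: c; c - r c; c + r c] | c <- finmap.enum_fset D]
                    | 0 <= s <= 1].
exists S; split; rewrite ?inE ?eqxx ?orbT//.
  move=> s; rewrite !inE mem_filter => /or3P[/eqP->|/eqP->|/andP[]//].
    by rewrite lexx ler01.
  by rewrite lexx ler01.
move=> u v uv.
have [|c /= cD uc] := Dcov (val u); first by rewrite /= in_itv/= unit_intervalP.
have [rc0 hc] := hr c.
have memS s : s \in [:: c; c - r c; c + r c] -> (s <= val u) = (s <= val v).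
  move=> sc; have /andP[u0 u1] := unit_intervalP u.
  have /andP[v0 v1] := unit_intervalP v.
  have [s0|s0] := ltP s 0.
    by rewrite !(le_trans (ltW s0)).
  have [s1|s1] := ltP 1 s.
    by rewrite !leNgt !(le_lt_trans _ s1).
  apply: uv; rewrite !inE mem_filter s0 s1 /=; apply/orP; right; apply/orP; right.
  by apply/flatten_mapP; exists c.
have h1 := memS c; have h2 := memS (c - r c); have h3 := memS (c + r c).
move: h1 h2 h3; rewrite !inE !eqxx !orbT => /(_ isT) h1 /(_ isT) h2 /(_ isT) h3.
move: uc; rewrite /ball/= ltr_norml => /andP[uc1 uc2].
have cu : c - r c <= val u by rewrite lerBlDl -lerBlDr ltW.
have uc : ~~ (c + r c <= val u).
  by rewrite -ltNge addrC -ltrBlDr -ltrN2 opprB.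
rewrite h2 in cu; rewrite h3 -ltNge in uc.
have c01 : 0 <= c <= 1 by have /set_mem := D01 _ cD; rewrite /= in_itv.
have [z zc] := unit_interval_ex c01.
apply: (hc z) => //; rewrite ler_norml; apply/andP; split; lra.
Qed.
End cadlag_oscillation.

(** * Time changes close to the identity *)

Section time_changes.
Context (R : realType).
Local Notation I := (unit_interval R).

Lemma seq_argmin (T : eqType) (S : seq T) (F : T -> R) (s0 : T) :
  s0 \in S -> exists2 s, s \in S & forall s', s' \in S -> F s <= F s'.
Proof.
elim: S s0 => [//|a S ih] s0 _.
case: S ih => [_|b S ih].
  by exists a; rewrite ?mem_head// => s'; rewrite inE => /eqP ->.
have [s sS smin] := ih b (mem_head _ _).
have [Fas|Fsa] := leP (F a) (F s).
  exists a; rewrite ?mem_head// => s'; rewrite inE => /predU1P[->//|/smin].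
  exact: le_trans.
exists s; first by rewrite inE sS orbT.
by move=> s'; rewrite inE => /predU1P[->|/smin//]; exact: ltW.
Qed.

Lemma seq_pos_lbound (S : seq R) :
  exists2 r : R, 0 < r & forall s, s \in S -> 0 < s -> r <= s.
Proof.
elim: S => [|a S [r r0 rS]]; first by exists 1.
have [a0|a0] := ltP 0 a; last first.
  exists r => // s; rewrite inE => /predU1P[->|/rS//].
  by rewrite ltNge a0.
exists (Num.min a r); first by rewrite lt_min a0.
move=> s; rewrite inE => /predU1P[->|/rS rs] s0.
  by rewrite ge_min lexx.
by rewrite ge_min rs ?orbT.
Qed.

(** McShane's formula: [h t] is the minimum over [s] in [S] of
    [v s + L * `|t - s|]. *)
Lemma lipschitz_extension (S : seq R) (v : R -> R) (L : R) (s0 : R) :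
  s0 \in S -> 0 <= L ->
  (forall s s', s \in S -> s' \in S -> v s <= v s' + L * `|s - s'|) ->
  exists h : R -> R, (forall s, s \in S -> h s = v s) /\
    forall t t', `|h t - h t'| <= L * `|t - t'|.
Proof.
move=> s0S L0 vL.
have /choice[m mP] (t : R) : exists m, m \in S /\
    forall s, s \in S -> v m + L * `|t - m| <= v s + L * `|t - s|.
  have [m mS mmin] := seq_argmin (fun s => v s + L * `|t - s|) s0S.
  by exists m.
pose h t := v (m t) + L * `|t - m t|.
have h1 t t' : h t - h t' <= L * `|t - t'|.
  have [m'S _] := mP t'; have [mS mmin] := mP t.
  rewrite lerBlDr (le_trans (mmin _ m'S))// /h [leRHS]addrCA lerD2l -mulrDr.
  by rewrite ler_wpM2l// ler_distD.
exists h; split => [s sS|t t'].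
  have [mS mmin] := mP s; apply/eqP; rewrite eq_le; apply/andP; split.
    by rewrite /h (le_trans (mmin _ sS))// subrr normr0 mulr0 addr0.
  exact: vL.
by rewrite ler_norml h1 andbT lerNl opprB distrC h1.
Qed.

Lemma lipschitz_continuous (h : R -> R) (L : R) : 0 <= L ->
  (forall t t', `|h t - h t'| <= L * `|t - t'|) -> continuous h.
Proof.
move=> L0 hL t; apply/cvgrPdist_le => e e0.
have L1 : 0 < L + 1 by rewrite ltr_wpDl.
near=> u; apply: (le_trans (hL _ _)).
apply: (@le_trans _ _ ((L + 1) * `|t - u|)); first by rewrite ler_wpM2r// lerDl.
rewrite mulrC -ler_pdivlMr//; near: u.
by apply: (cvgr_dist_le _ _ (@cvg_id _ (nbhs t))); rewrite divr_gt0.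
Unshelve. all: by end_near. Qed.

(** Perturbing the identity by an [L]-Lipschitz function with [L < 1] keeps it
    strictly increasing, hence bijective by the intermediate value theorem, and
    all slopes stay within [L] of 1. Time changes with prescribed values at
    finitely many points and small logarithmic slopes come from here. *)
Lemma perturbed_time_change (h : R -> R) (L : R) : 0 <= L -> L < 1 ->
  (forall t t', `|h t - h t'| <= L * `|t - t'|) -> h 0 = 0 -> h 1 = 0 ->
  exists l : I -> I, [/\ time_change l, (forall t, val (l t) = val t + h (val t)) &
    forall s t, val s < val t ->
      1 - L <= (val (l t) - val (l s)) / (val t - val s) <= 1 + L].
Proof.
move=> L0 L1 hL h0 h1.
pose f t := t + h t.
have fd s t : s < t -> (1 - L) * (t - s) <= f t - f s <= (1 + L) * (t - s).
  move=> st; have := hL t s; rewrite ler_norml (gtr0_norm (_ : 0 < t - s)) ?subr_gt0//.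
  by rewrite /f => /andP[h2 h3]; apply/andP; split; lra.
have fmono s t : s < t -> f s < f t.
  move=> st; have /andP[+ _] := fd _ _ st; rewrite -subr_gt0; apply: lt_le_trans.
  by rewrite mulr_gt0// subr_gt0.
have fmonow s t : s <= t -> f s <= f t.
  by rewrite le_eqVlt => /predU1P[->//|/fmono/ltW].
have f0 : f 0 = 0 by rewrite /f h0 addr0.
have f1 : f 1 = 1 by rewrite /f h1 addr0.
have f01 (t : I) : 0 <= f (val t) <= 1.
  have /andP[t0 t1] := unit_intervalP t.
  by have := fmonow _ _ t0; have := fmonow _ _ t1; rewrite f0 f1 => -> ->.
have /choice[l lE] (t : I) : exists z : I, val z = f (val t).
  exact: unit_interval_ex.
have lmono s t : val s < val t -> val (l s) < val (l t) by rewrite !lE; exact: fmono.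
have cf : continuous f.
  by move=> t; apply: cvgD; [exact: cvg_id|exact: (lipschitz_continuous L0 hL)].
have /choice[k kE] (y : I) : exists z : I, l z = y.
  have := @IVT R f 0 1 (val y) ler01 (continuous_subspaceT cf).
  rewrite f0 f1 minElt maxElt ltr01 unit_intervalP => /(_ isT)[c c01 cy].
  have [z zc] : exists z : I, val z = c.
    by apply: unit_interval_ex; move: c01; rewrite in_itv.
  by exists z; apply: val_inj; rewrite lE zc.
exists l; split => //.
  split => //; exists k => //.
  move=> t; apply: val_inj; have [kt|tk|//] := ltgtP (val (k (l t))) (val t).
    by have := lmono _ _ kt; rewrite kE ltxx.
  by have := lmono _ _ tk; rewrite kE ltxx.
move=> s t st; rewrite !lE ler_pdivlMr ?ler_pdivrMr ?subr_gt0//; exact: fd.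
Qed.

(** The bound on [L] is what makes [1 - L >= (1 + e)^-1], so that both
    estimates reduce to [1 + e <= expR e]. *)
Lemma ln_near1 (e L r : R) : 0 < e -> 0 <= L -> L <= e / (1 + e) ->
  1 - L <= r <= 1 + L -> `|ln r| <= e.
Proof.
move=> e0 L0 Le /andP[r1 r2].
have e10 : 0 < 1 + e by rewrite addr_gt0.
have eE : 1 - e / (1 + e) = (1 + e)^-1 by field; rewrite gt_eqF.
have r0 : 0 < r.
  apply: lt_le_trans r1; apply: (@lt_le_trans _ _ (1 + e)^-1); first by rewrite invr_gt0.
  by rewrite -eE lerD2l lerN2.
rewrite ler_norml -ler_expR -[X in _ && X]ler_expR lnK ?posrE//; apply/andP; split.
  apply: le_trans r1; apply: (@le_trans _ _ (1 + e)^-1); last first.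
    by rewrite -eE lerD2l lerN2.
  by rewrite expRN lef_pV2 ?posrE ?expR_gt0// expR_ge1Dx.
apply: (le_trans r2); apply: le_trans (expR_ge1Dx e).
by rewrite lerD2l (le_trans Le)// ler_pdivrMr// ler_peMr ?(ltW e0)// lerDl (ltW e0) .
Qed.

End time_changes.

(** * Approximation by quantised step paths *)

Section grid.
Context (R : realType).
Local Notation I := (unit_interval R).

Lemma unit_interval0 : (0 : R) \in ([set` `[0%R : R, 1%R]] : set R).
Proof. by apply/mem_set; rewrite /= in_itv/= lexx ler01. Qed.

Definition unit_pt (r : R) : I := insubd (exist _ 0 unit_interval0 : I) r.

Lemma unit_ptE (r : R) : 0 <= r <= 1 -> val (unit_pt r) = r.
Proof. by move=> r01; apply: insubdK; apply/mem_set; rewrite /= in_itv. Qed.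

(** The mesh is [1 / n.+1]; the index [n.+1] is reached only at [t = 1]. *)
Definition grid_index (n : nat) (t : I) : 'I_n.+2 :=
  inord (Num.truncn (n.+1%:R * val t)).

Lemma val_grid_index n (t : I) :
  (grid_index n t : nat) = Num.truncn (n.+1%:R * val t).
Proof.
have /andP[t0 t1] := unit_intervalP t.
rewrite /grid_index inordK// ltnS truncn_le_nat.
by rewrite (@le_lt_trans _ _ n.+1%:R) ?ltr_nat// ler_piMr.
Qed.

Lemma grid_index_eq n k (t : I) :
  ((grid_index n t : nat) == k) = (k%:R <= n.+1%:R * val t < k.+1%:R).
Proof.
by rewrite val_grid_index truncn_eq// mulr_ge0//; have /andP[] := unit_intervalP t.
Qed.

Lemma nbhs_unit_interval (t : I) (P : I -> Prop) (r : R) : 0 < r ->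
  (forall s : I, `|val s - val t| < r -> P s) -> \forall s \near nbhs t, P s.
Proof.
move=> r0 rP; apply/nbhs_ballP; exists r => // s ts.
by apply: rP; rewrite distrC; exact: ts.
Qed.

End grid.

Section step_paths.
Context (R : realType) (d : nat).
Local Notation I := (unit_interval R).
Local Notation V := 'rV[R]_d.+1.

(** Such a path is constant just to the right and just to the left of every
    point. The left limit at a grid point is the value of the preceding cell. *)
Lemma cadlag_grid_step n (M : 'I_n.+2 -> V) : cadlag (fun t => M (grid_index n t)).
Proof.
have N0 : 0 < n.+1%:R :> R by [].
move=> t; split.
  apply: cvg_near_cst.
  have := grid_index_eq n (grid_index n t) t; rewrite eqxx => /esym/andP[kt tk].
  apply: (@nbhs_unit_interval _ _ _ ((grid_index n t).+1%:R / n.+1%:R - val t)).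
    by rewrite subr_gt0 ltr_pdivlMr// mulrC.
  move=> s; rewrite ltr_norml ltrBlDr subrK => /andP[_ sk] ts.
  congr M; apply: val_inj; apply/eqP; rewrite grid_index_eq.
  rewrite (le_trans kt) ?ler_wpM2l ?(ltW ts)//=.
  by rewrite mulrC -ltr_pdivlMr.
have /andP[t0 t1] := unit_intervalP t.
move: (t0); rewrite le_eqVlt => /predU1P[t00|t00].
  exists 0; apply: cvg_near_cst; apply: (@nbhs_unit_interval _ _ _ 1) => // s _ /=.
  by rewrite -t00 ltNge; have /andP[-> _] := unit_intervalP s.
have [k /andP[kt tk]] : exists k : nat, k%:R < n.+1%:R * val t <= k.+1%:R.
  have := grid_index_eq n (grid_index n t) t; rewrite eqxx => /esym/andP[].
  move: (nat_of_ord _) => k; rewrite le_eqVlt => /predU1P[kt _|kt /ltW tk]; last by exists k; rewrite kt.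
  case: k kt => [/esym/eqP|k kt].
    by rewrite mulf_eq0 pnatr_eq0/= (gt_eqF t00).
  by exists k; rewrite -kt lexx ltr_nat ltnS leqnn.
exists (M (inord k)); apply: cvg_near_cst.
apply: (@nbhs_unit_interval _ _ _ (val t - k%:R / n.+1%:R)).
  by rewrite subr_gt0 ltr_pdivrMr// mulrC.
move=> s; rewrite ltr_norml opprB => /andP[ks _] st.
rewrite -(_ : grid_index n s = k :> nat) ?inord_val//.
apply/eqP; rewrite grid_index_eq; apply/andP; split.
  by rewrite mulrC -ler_pdivrMr// ltW// -(ltrD2r (- val t)).
by apply: lt_le_trans tk; rewrite ltr_pM2l.
Qed.

(** The code [M] is an integer matrix, so that for fixed [n] there are only
    countably many such paths; dividing by [n.+1] makes the values fine as well as
    the mesh. *)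
Definition step_path n (M : 'M[int]_(n.+2, d.+1)) : skorokhod R d :=
  Skorokhod (cadlag_grid_step (fun k : 'I_n.+2 => (\row_i ((M k i)%:~R / n.+1%:R) : V))).

Definition quantize n (x : skorokhod R d) : 'M[int]_(n.+2, d.+1) :=
  \matrix_(k, i) Num.floor (n.+1%:R * x (unit_pt (k%:R / n.+1%:R)) ord0 i).

Lemma step_path_quantize n (x : skorokhod R d) (t : I) :
  `|x (unit_pt ((grid_index n t)%:R / n.+1%:R)) - step_path (quantize n x) t|
    <= n.+1%:R^-1.
Proof.
have N0 : 0 < n.+1%:R :> R by [].
rewrite [leLHS]mx_normrE; apply: bigmax_le => [|[i j] _ /=]; first by rewrite invr_ge0.
rewrite ord1 !mxE; set y := x _ _ _.
have /andP[yl yu] := floor_itv (n.+1%:R * y).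
rewrite -(ler_pM2l N0) -{1}(gtr0_norm N0) -normrM mulrBr mulrCA !divff ?gt_eqF// mulr1.
move: yu; rewrite intrD => yu.
by rewrite ger0_norm ?subr_ge0// lerBlDr addrC ltW.
Qed.

(** Each point [s] of [S] is moved up to the next grid point
    [Num.ceil (n.+1 * s) / n.+1]. A number is at least an integer exactly when its
    integer part is, so afterwards rounding [l t] down to the grid does not
    cross any point of [S]: this is what lets a path sampled on the grid be compared
    with [x t] although the jumps of [x] are off the grid. The displacements are
    at most the mesh, whence the Lipschitz constant [L] for points of [S] at
    mutual distance at least [r]. *)
Lemma grid_time_change n (S : seq R) (r : R) :
  0 \in S -> 1 \in S -> (forall s, s \in S -> 0 <= s <= 1) ->
  0 < r -> (forall s s', s \in S -> s' \in S -> s != s' -> r <= `|s - s'|) ->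
  let L := (n.+1%:R * r)^-1 in L < 1 ->
  exists l : I -> I, [/\ time_change l,
    (forall s t, val s < val t ->
      1 - L <= (val (l t) - val (l s)) / (val t - val s) <= 1 + L) &
    forall s (t : I), s \in S ->
      (s <= val t) = (s <= val (unit_pt ((grid_index n (l t))%:R / n.+1%:R)))].
Proof.
move=> S0 S1 S01 r0 Sr L L1.
have N0 : 0 < n.+1%:R :> R by [].
have L0 : 0 <= L by rewrite invr_ge0 mulr_ge0// ltW.
(* v s is the displacement of s to the next grid point. *)
pose v s : R := (Num.ceil (n.+1%:R * s))%:~R / n.+1%:R - s.
have v01 s : 0 <= v s <= n.+1%:R^-1.
  have /andP[cl cu] := ceil_itv (n.+1%:R * s); rewrite intrB in cl.
  rewrite subr_ge0 ler_pdivlMr// mulrC cu /=.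
  by rewrite lerBlDl ler_pdivrMr// mulrDl mulVf ?gt_eqF// [s * _]mulrC -lerBlDr ltW.
have [h [hS hL]] : exists h : R -> R, (forall s, s \in S -> h s = v s) /\
    forall t t', `|h t - h t'| <= L * `|t - t'|.
  apply: (lipschitz_extension S0 L0) => s s' sS s'S.
  have [->|ss'] := eqVneq s s'; first by rewrite lerDl mulr_ge0.
  have /andP[_ vs] := v01 s; have /andP[vs' _] := v01 s'.
  apply: (le_trans vs); apply: (@le_trans _ _ (L * `|s - s'|)); last by rewrite lerDr.
  by rewrite /L invfM -mulrA ler_peMr ?invr_ge0// mulrC ler_pdivlMr// mul1r Sr.
have h0 : h 0 = 0 by rewrite hS// /v mulr0 ceil0 mul0r subrr.
have h1 : h 1 = 0.
  by rewrite hS// /v mulr1 -[n.+1%:R]/((Posz n.+1)%:~R) intrKceil divff ?subrr ?gt_eqF.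
have [l [tl lE lL]] := perturbed_time_change L0 L1 hL h0 h1.
exists l; split => // s t sS.
have [z zs] := unit_interval_ex (S01 _ sS).
have -> : (s <= val t) = (val (l z) <= val (l t)).
  rewrite -zs; apply/idP/idP; first exact: time_change_le.
  by rewrite leNgt => zt; rewrite leNgt; apply: contra zt; apply: (proj2 tl).
have -> : val (l z) = (Num.ceil (n.+1%:R * s))%:~R / n.+1%:R.
  by rewrite lE zs hS// /v addrC subrK.
have /andP[lt0 lt1] := unit_intervalP (l t).
have Nlt0 : 0 <= n.+1%:R * val (l t) by rewrite mulr_ge0.
rewrite unit_ptE; last first.
  rewrite divr_ge0//= ler_pdivrMr// mul1r ler_nat.
  by rewrite -ltnS ltn_ord.
rewrite ler_pdivrMr// [X in _ <= X]mulrC -floor_ge_int ler_pdivlMr// [s * _]mulrC.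
rewrite val_grid_index -[(Num.truncn _)%:R]/((Posz (Num.truncn _))%:~R) -ceil_le_int.
by rewrite truncn_floor Nlt0 gez0_abs// floor_ge0.
Qed.

(** Quantised step paths converge in the Skorokhod metric. The time
    change of [grid_time_change] keeps [t] and the sampling point of [l t]
    in the same piece of a partition on whose pieces [x] oscillates little; the
    second half of the error is the rounding of the values. *)
Lemma step_path_approx (x : skorokhod R d) (e : R) : 0 < e ->
  \forall n \near \oo, mdist x (step_path (quantize n x)) <= e.
Proof.
move=> e0.
have D0 : 0 < d.+1%:R :> R by [].
have e10 : 0 < e / (2 * d.+1%:R) by rewrite divr_gt0// mulr_gt0.
have [S [S0 S1 S01 Sx]] := cadlag_partition x e10.
have [r r0 rS] := seq_pos_lbound [seq `|s - s'| | s <- S, s' <- S].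
have {}rS s s' : s \in S -> s' \in S -> s != s' -> r <= `|s - s'|.
  move=> sS s'S ss'; apply: rS; last by rewrite normr_gt0 subr_eq0.
  by apply/allpairsP; exists (s, s').
pose c := e / (1 + e).
have e1 : 0 < 1 + e by rewrite addr_gt0.
have c0 : 0 < c by rewrite divr_gt0.
have c1 : c < 1 by rewrite ltr_pdivrMr// mul1r ltrDr.
pose K := (r * c)^-1 + 2 * d.+1%:R / e.
exists (Num.truncn K) => // n /= Kn.
have N0 : 0 < n.+1%:R :> R by [].
have KN : K <= n.+1%:R.
  by rewrite ltW// (lt_le_trans (truncnS_gt K))// ler_nat ltnS.
have [K1 K2] : (r * c)^-1 <= n.+1%:R /\ 2 * d.+1%:R / e <= n.+1%:R.
  have p1 : 0 < (r * c)^-1 by rewrite invr_gt0 mulr_gt0.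
  have p2 : 0 < 2 * d.+1%:R / e by rewrite divr_gt0// mulr_gt0.
  by split; apply: le_trans KN; rewrite ?lerDl ?lerDr ltW.
have Lc : (n.+1%:R * r)^-1 <= c.
  rewrite -[leRHS]invrK lef_pV2 ?posrE ?invr_gt0 ?(mulr_gt0 N0 r0)//.
  by move: K1; rewrite invfM mulrC ler_pdivrMr.
have [l [tl lL lS]] :=
  grid_time_change S0 S1 S01 r0 rS (le_lt_trans Lc c1).
apply: (@J1_dist_le _ _ _ _ _ l); split => // [s t st|t].
  by apply: (ln_near1 e0 _ Lc (lL _ _ st)); rewrite invr_ge0 mulr_ge0// ltW.
pose z : I := unit_pt ((grid_index n (l t))%:R / n.+1%:R).
rewrite -(subrKA (x z)) (le_trans (enormD _ _))// (splitr e) lerD//.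
  apply: (le_trans (enorm_le_norm _)); rewrite mulrC -ler_pdivlMr//.
  by rewrite -mulrA -invfM Sx// => s sS; exact: lS.
apply: (le_trans (enorm_le_norm _)); rewrite mulrC -ler_pdivlMr//.
apply: (le_trans (step_path_quantize _ _ _)).
rewrite -mulrA -invfM -[leRHS]invrK lef_pV2 ?posrE ?invr_gt0// ?divr_gt0 ?mulr_gt0//.
by rewrite invf_div.
Qed.

End step_paths.

(** * Supremum norm, scaling and polar coordinates *)

Section paths.
Context (R : realType) (d : nat).
Local Notation I := (unit_interval R).
Implicit Types (x y : skorokhod R d) (c r e : R).

Lemma enormZ c (v : 'rV[R]_d.+1) : enorm (c *: v) = `|c| * enorm v.
Proof.
rewrite /enorm -sqrtr_sqr -sqrtrM ?sqr_ge0// mulr_sumr.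
by congr Num.sqrt; apply: eq_bigr => i _; rewrite mxE exprMn.
Qed.

Lemma enorm_le_supnorm x t : enorm (x t) <= supnorm x.
Proof.
apply: ub_le_sup; last by exists t.
by have [M xM] := cadlag_bounded x; exists M => _ [s _ <-].
Qed.

Lemma supnorm_le x M : (forall t, enorm (x t) <= M) -> supnorm x <= M.
Proof.
move=> xM; apply: ge_sup; last by move=> _ [t _ <-].
by exists (enorm (x (unit_pt 0))); exists (unit_pt 0).
Qed.

Lemma supnorm_ge0 x : 0 <= supnorm x.
Proof. exact: le_trans (enorm_ge0 _) (enorm_le_supnorm x (unit_pt 0)). Qed.

Lemma supnorm_skscale c x : supnorm (skscale c x) = `|c| * supnorm x.
Proof.
apply/eqP; rewrite eq_le; apply/andP; split.
  by apply: supnorm_le => t /=; rewrite enormZ ler_wpM2l// enorm_le_supnorm.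
have [->|c0] := eqVneq c 0; first by rewrite normr0 mul0r supnorm_ge0.
rewrite -ler_pdivlMl ?normr_gt0//; apply: supnorm_le => t.
rewrite ler_pdivlMl ?normr_gt0// -enormZ.
exact: (enorm_le_supnorm (skscale c x) t).
Qed.

(** A time change permutes the values of a path, so only the spatial part of
    the distance matters. *)
Lemma supnorm_lipschitz x y : `|supnorm x - supnorm y| <= mdist x y.
Proof.
suff h : forall u v : skorokhod R d, supnorm u - supnorm v <= J1_dist u v.
  by rewrite ler_norml h andbT lerNl opprB metric_sym h.
move=> {x y} u v; apply/ler_addgt0Pr => e e0.
have /J1_dist_lt[l [_ _ ul]] : J1_dist u v < J1_dist u v + e by rewrite ltrDl.
rewrite lerBlDr; apply: supnorm_le => t.
rewrite -(subrK (v (l t)) (u t)) (le_trans (enormD _ _))// lerD//.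
exact: enorm_le_supnorm.
Qed.

Lemma mdist_skscale c x y : 0 <= c ->
  mdist (skscale c x) (skscale c y) <= Num.max 1 c * mdist x y.
Proof.
move=> c0; have m0 : 0 < Num.max 1 c by rewrite lt_max ltr01.
have de0 := J1_dist_ge0 x y.
change (J1_dist (skscale c x) (skscale c y) <= Num.max 1 c * J1_dist x y).
rewrite mulrC -ler_pdivrMr//; apply/ler_addgt0Pr => e e0; rewrite ler_pdivrMr//.
have /J1_dist_lt[l [tl ul xl]] : J1_dist x y < J1_dist x y + e by rewrite ltrDl.
have {}de0 : 0 <= J1_dist x y + e by rewrite addr_ge0// ltW.
apply: (@J1_dist_le _ _ _ _ _ l); split => // [s t st|t].
  by rewrite (le_trans (ul _ _ st))// ler_peMr// le_max lexx.
rewrite /= -scalerBr enormZ (ger0_norm c0) [leRHS]mulrC ler_pM ?enorm_ge0//.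
by rewrite le_max lexx orbT.
Qed.

Lemma mdist_skscale_coef c c' x :
  mdist (skscale c x) (skscale c' x) <= `|c - c'| * supnorm x.
Proof.
apply: (@J1_dist_le _ _ _ _ _ id); split.
- exact: time_change_id.
- move=> s t st; rewrite divff ?gt_eqF ?subr_gt0// ln1 normr0.
  by rewrite mulr_ge0// supnorm_ge0.
- by move=> t /=; rewrite -scalerBl enormZ ler_wpM2l// enorm_le_supnorm.
Qed.

Lemma supnorm_normalized x : 0 < supnorm x ->
  supnorm (skscale (supnorm x)^-1 x) = 1.
Proof.
by move=> x0; rewrite supnorm_skscale gtr0_norm ?invr_gt0// mulVf ?gt_eqF.
Qed.

(** The null path has no polar coordinates. *)
Definition polar_pt x : Dbar0 R d :=
  match pselect (0 < supnorm x) with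
  | left x0 => @MkDbar0 R d (supnorm x)%:E (skscale (supnorm x)^-1 x)
      (etrans (lte_fin _ _) x0) (supnorm_normalized x0)
  | right _ => Dbar0_point R d
  end.

Lemma polar_ptP x : 0 < supnorm x -> polar_of x (polar_pt x).
Proof. by rewrite /polar_pt; case: pselect. Qed.

Lemma paths_inP (B : set (Dbar0 R d)) x :
  paths_in B x <-> 0 < supnorm x /\ B (polar_pt x).
Proof.
split=> [[p Bp xp]|[x0 Bx]]; last by exists (polar_pt x) => //; exact: polar_ptP.
have x0 : 0 < supnorm x by rewrite -lte_fin -(proj1 xp) radius_gt0.
split=> //; suff -> : polar_pt x = p by [].
have [px qx] := polar_ptP x0.
case: p xp {Bp} => r a r0 a1 [/= rE aE]; subst r a.
move: px qx; case: (polar_pt x) => r a r0' a1' /= rE aE; subst r a.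
by congr MkDbar0; exact: Prop_irrelevance.
Qed.

Lemma inv_radius_polar x : 0 < supnorm x -> inv_radius (polar_pt x) = (supnorm x)^-1.
Proof.
by move=> x0; rewrite /inv_radius (proj1 (polar_ptP x0)) inver gt_eqF.
Qed.

(** Passing to polar coordinates is uniformly continuous away from the null
    path. [K * e] collects the three contributions: the inverse radii differ by at
    most [2 * e / c ^+ 2]; the angles differ by [(1 + c^-1) * e] from normalising
    both paths with the same factor, and by [c^-1 * e] from exchanging the
    factor. *)
Lemma polar_unif c r : 0 < c -> 0 < r -> exists2 e : R, 0 < e &
  forall x y, c <= supnorm x -> mdist x y <= e ->
    0 < supnorm y /\ mdist (polar_pt x) (polar_pt y) < r.
Proof.
move=> c0 r0; pose K := 1 + 2 * c^-1 + 2 / c ^+ 2.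
have ci : 0 < c^-1 by rewrite invr_gt0.
have cci : 0 < 2 / c ^+ 2 by rewrite divr_gt0// exprn_gt0.
have K0 : 0 < K by rewrite /K !addr_gt0// mulr_gt0.
pose e := Num.min (c / 2) (r / 2 / K).
have [ec er] : e <= c / 2 /\ K * e < r.
  split; first by rewrite ge_min lexx.
  apply: (@le_lt_trans _ _ (r / 2)); last by rewrite ltr_pdivrMr// ltr_pMr// ltr1n.
  by rewrite mulrC -ler_pdivlMr// ge_min lexx orbT.
have e0 : 0 < e by rewrite lt_min !divr_gt0.
exists e => // x y xc xy.
have x0 : 0 < supnorm x by exact: lt_le_trans xc.
have sxy : `|supnorm x - supnorm y| <= e := le_trans (supnorm_lipschitz x y) xy.
have yc : c / 2 <= supnorm y.
  by move: sxy; rewrite ler_norml => /andP[_]; move: ec xc; lra.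
have y0 : 0 < supnorm y by apply: lt_le_trans yc; rewrite divr_gt0.
split => //; apply: le_lt_trans er; rewrite /mdist/= /Dbar0_dist ge_max.
have invd : `|(supnorm x)^-1 - (supnorm y)^-1| =
    `|supnorm x - supnorm y| / (supnorm x * supnorm y).
  rewrite -[X in _ / X]gtr0_norm ?mulr_gt0// -normfV -normrM distrC; congr `|_|.
  by field; rewrite !gt_eqF.
have xci : (supnorm x)^-1 <= c^-1 by rewrite lef_pV2 ?posrE.
apply/andP; split.
  rewrite !inv_radius_polar// invd (@le_trans _ _ (e * (2 / c ^+ 2)))//.
    rewrite ler_pM ?invr_ge0 ?mulr_ge0 ?supnorm_ge0//.
    rewrite -[leRHS]invrK lef_pV2 ?posrE ?mulr_gt0 ?invr_gt0// invf_div.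
    by rewrite expr2 -mulrA ler_pM// ?divr_ge0// ltW.
  by rewrite mulrC ler_wpM2r ?(ltW e0)// /K lerDr addr_ge0// mulr_ge0// ltW.
rewrite (proj2 (polar_ptP x0)) (proj2 (polar_ptP y0)).
rewrite (le_trans (metric_triangle _ (skscale (supnorm x)^-1 y) _))//.
apply: (@le_trans _ _ ((1 + c^-1) * e + c^-1 * e)); last first.
  by rewrite -mulrDl ler_wpM2r ?(ltW e0)// /K -addrA -mulr2n mulr_natl lerDl ltW.
rewrite lerD//.
  rewrite (le_trans (mdist_skscale _ _ _)) ?invr_ge0 ?supnorm_ge0//.
  rewrite ler_pM ?mdist_ge0// ?le_max ?ler01//.
  by rewrite ge_max lerDl (ltW ci)/= (le_trans xci)// lerDr.
rewrite (le_trans (mdist_skscale_coef _ _ _))// invd invfM mulrA mulfVK ?gt_eqF//.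
by rewrite mulrC ler_pM// invr_ge0 ltW.
Qed.

End paths.

(** * Measurability of path events *)

Lemma mdist_lipschitz2 (R : realFieldType) (T : metricType R) (x y x' y' : T) :
  `|mdist x y - mdist x' y'| <= mdist x x' + mdist y y'.
Proof.
have h (a b a' b' : T) : mdist a b - mdist a' b' <= mdist a a' + mdist b b'.
  rewrite lerBlDr (le_trans (metric_triangle _ a' _))// -addrA lerD2l addrC.
  by rewrite (metric_sym b) metric_triangle.
rewrite ler_norml; apply/andP; split; last exact: h.
by rewrite lerNl opprB (metric_sym x x') (metric_sym y y'); exact: h.
Qed.

Section discretization.
Context (R : realType) (d : nat) (disp : measure_display)
  (Omega : measurableType disp).
Implicit Types X Y : Omega -> skorokhod R d.

(** A limit of maps [fn n] for which every preimage is measurable: [f w] lies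
    in the open set [G] iff, for some fixed radius, the balls around [fn n w] are
    eventually contained in [G]. Countably valued approximations have this strong
    measurability. *)
Lemma limit_preimage_measurable (T : pseudoMetricType R) (D : set Omega)
    (f : Omega -> T) (fn : nat -> Omega -> T) (G : set T) :
  measurable D -> (forall n (A : set T), measurable (fn n @^-1` A)) ->
  (forall w, D w -> fn n w @[n --> \oo] --> f w) -> open G ->
  measurable (D `&` f @^-1` G).
Proof.
move=> mD mfn fnf oG.
pose A k : set T := [set p | ball p k.+1%:R^-1 `<=` G].
rewrite (_ : _ `&` _ =
  D `&` \bigcup_k \bigcup_N \bigcap_(n in [set n | (N <= n)%N]) fn n @^-1` A k).
  apply: measurableI => //; apply: bigcupT_measurable => k.
  by apply: bigcupT_measurable => N; apply: bigcap_measurableType => n _; exact: mfn.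
apply/seteqP; split => w [Dw].
  move=> Gw; split => //.
  have [e /= e0 eG] : exists2 e : R, 0 < e & ball (f w) e `<=` G.
    by move: oG; rewrite openE => /(_ _ Gw)/nbhs_ballP.
  have e20 : 0 < e / 2 by rewrite divr_gt0.
  have [k _ /(_ _ (leqnn k))/= ke] := near_infty_natSinv_lt (PosNum e20).
  have [N _ hN] := (cvg_ballP _ _).1 (fnf w Dw) _ e20.
  exists k => //; exists N => // n /= /hN fwn q.
  move=> /(le_ball (ltW ke)) hq; apply: eG; rewrite (splitr e).
  exact: ball_triangle hq.
move=> [k _ [N _ hN]]; split => //=.
have k0 : 0 < k.+1%:R^-1 :> R by rewrite invr_gt0.
have [M _ hM] := (cvg_ballP _ _).1 (fnf w Dw) _ k0.
by apply: (hN (maxn N M) (leq_maxl _ _)); apply: ball_sym; exact/hM/leq_maxr.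
Qed.

Lemma countable_preimage_measurable (T : countType) (f : Omega -> T) :
  (forall z, measurable (f @^-1` [set z])) ->
  forall A : set T, measurable (f @^-1` A).
Proof.
move=> mf A; rewrite (_ : _ @^-1` _ =
    \bigcup_(z in [set: T]) if `[< A z >] then f @^-1` [set z] else set0).
  apply: countable_bigcupT_measurable => [|z]; first exact: countableP.
  by case: ifP.
apply/seteqP; split => [w Aw|w [z _]].
  by exists (f w) => //; case: asboolP.
by case: asboolP => //= Az ->.
Qed.

Lemma quantize_measurable n X (M : 'M[int]_(n.+2, d.+1)) : process X ->
  measurable [set w | quantize n (X w) = M].
Proof.
move=> mX; rewrite (_ : mkset _ = \bigcap_(ki in [set: 'I_n.+2 * 'I_d.+1])
  [set w | (M ki.1 ki.2)%:~R <=
     n.+1%:R * X w (unit_pt (ki.1%:R / n.+1%:R)) ord0 ki.2 <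
     (M ki.1 ki.2 + 1)%:~R]); last first.
  apply/seteqP; split => [w /= <- [k i] _ /=|w /= h].
    by rewrite mxE; exact: floor_itv.
  by apply/matrixP => k i; rewrite mxE; apply: floor_def; exact: (h (k, i)).
apply: fin_bigcap_measurable => [|[k i] _ /=]; first exact: finite_finset.
pose y w : R := n.+1%:R * X w (unit_pt (k%:R / n.+1%:R)) ord0 i.
have my : measurable_fun setT y by apply: measurable_funM => //; exact: mX.
have := my measurableT _ (measurable_itv `[(M k i)%:~R, (M k i + 1)%:~R[).
by rewrite setTI; congr measurable; apply/seteqP; split => w; rewrite /= in_itv.
Qed.

Lemma process_skscale (c : R) X : process X -> process (fun w => skscale c (X w)).
Proof.
move=> mX t i; rewrite [X in measurable_fun _ X](_ : _ =
  (fun w => c * X w t ord0 i)); last by apply/funext => w; rewrite mxE.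
by apply: measurable_funM => //; exact: mX.
Qed.

Lemma step_path_cvg (x : skorokhod R d) :
  step_path R (quantize n x) @[n --> \oo] --> x.
Proof.
apply/metricType_numDomainType.cvgrPdist_le => e e0.
exact: step_path_approx.
Qed.

(** The pair of codes is again countably valued, and the distance of the two
    step paths converges to the distance of the paths. *)
Lemma measurable_mdist_gt (e : R) X Y : process X -> process Y ->
  measurable [set w | e < mdist (X w) (Y w)].
Proof.
move=> mX mY.
pose fn n w : R := mdist (step_path R (quantize n (X w))) (step_path R (quantize n (Y w))).
have -> : [set w | e < mdist (X w) (Y w)] =
    setT `&` (fun w => mdist (X w) (Y w) : R) @^-1` [set r : R | e < r].
  by rewrite setTI.
apply: (@limit_preimage_measurable R^o _ _ fn) => //.
  move=> n A; rewrite (_ : _ @^-1` _ = (fun w => (quantize n (X w), quantize n (Y w)))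
     @^-1` [set M | A (mdist (step_path R M.1) (step_path R M.2))])//.
  apply: countable_preimage_measurable => -[M N].
  rewrite (_ : _ @^-1` _ = [set w | quantize n (X w) = M] `&` [set w | quantize n (Y w) = N]).
    by apply: measurableI; exact: quantize_measurable.
  by apply/seteqP; split => w /= [-> ->].
move=> w _; apply/cvgrPdist_le => r r0.
have r20 : 0 < r / 2 by rewrite divr_gt0.
apply: filterS2 (step_path_approx (X w) r20) (step_path_approx (Y w) r20).
move=> n hx hy; rewrite (splitr r).
exact: (le_trans (mdist_lipschitz2 (X w) (Y w) _ _) (lerD hx hy)).
Qed.

Lemma measurable_supnorm_gt (c : R) X : process X ->
  measurable [set w | c < supnorm (X w)].
Proof.
move=> mX.
have -> : [set w | c < supnorm (X w)] =
    setT `&` X @^-1` [set x | c < supnorm x] by rewrite setTI.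
apply: (@limit_preimage_measurable _ _ _
  (fun n w => step_path R (quantize n (X w)))) => //.
- move=> n A; rewrite (_ : _ @^-1` _ =
    (fun w => quantize n (X w)) @^-1` [set M | A (step_path R M)])//.
  by apply: countable_preimage_measurable => M; exact: quantize_measurable.
- by move=> w _; exact: step_path_cvg.
- rewrite openE => x /= cx; apply/nbhs_ballP; exists (supnorm x - c) => /=.
    by rewrite subr_gt0.
  move=> y; rewrite ballEmdist /= => xy.
  by have := le_lt_trans (supnorm_lipschitz x y) xy; rewrite ltr_norml; lra.
Qed.

(** Polar coordinates are continuous off the null path, so there the polar
    coordinates of the step paths converge, which settles open [B]; these generate the
    Borel sets. *)
Lemma measurable_paths_in X (B : set (Dbar0 R d)) : process X ->
  measurable (B : set (borel (Dbar0 R d))) ->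
  measurable [set w | paths_in B (X w)].
Proof.
move=> mX mB; pose D := [set w | 0 < supnorm (X w)].
have mD : measurable D by exact: measurable_supnorm_gt.
pose f w : borel (Dbar0 R d) := polar_pt (X w).
have -> : [set w | paths_in B (X w)] = D `&` f @^-1` B.
  by apply/seteqP; split => w /=; rewrite paths_inP.
suff mf : measurable_fun D f by exact: mf.
apply: (@measurability _ _ _ _ D f open) => // _ [G oG <-].
apply: (@limit_preimage_measurable (Dbar0 R d) _ _
  (fun n w => polar_pt (step_path R (quantize n (X w))))) => //.
  move=> n A; rewrite (_ : _ @^-1` _ =
    (fun w => quantize n (X w)) @^-1` [set M | A (polar_pt (step_path R M))])//.
  by apply: countable_preimage_measurable => M; exact: quantize_measurable.
move=> w Dw; apply/metricType_numDomainType.cvgrPdist_lt => r r0.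
have [e e0 he] := polar_unif d Dw r0.
apply: filterS (step_path_approx (X w) e0) => n xn.
exact: proj2 (he _ _ (lexx _) xn).
Qed.

End discretization.

(** * Neighbourhoods of a boundary *)

Section near_sets.
Context (R : realType) (T : metricType R).
Implicit Types (A B : set T) (r : R).

Definition near_set r A : set T := [set p | exists2 q, A q & mdist p q < r].

Lemma sub_near_set r A : 0 < r -> A `<=` near_set r A.
Proof. by move=> r0 p Ap; exists p => //; rewrite mdistxx. Qed.

Lemma open_near_set r A : open (near_set r A).
Proof.
rewrite openE => p [q Aq pq]; apply/nbhs_ballP.
exists (r - mdist p q) => /=; first by rewrite subr_gt0.
move=> p'; rewrite ballEmdist /= => pp'; exists q => //.
rewrite (le_lt_trans (metric_triangle _ p _))// metric_sym.
by move: pp'; rewrite ltrBrDr.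
Qed.

Lemma closure_near_set r r' A : r < r' -> closure (near_set r A) `<=` near_set r' A.
Proof.
move=> rr' p cp; have rr0 : 0 < r' - r by rewrite subr_gt0.
have [p' [[q Aq p'q]]] := cp _ (nbhsx_ballx p _ rr0).
rewrite ballEmdist /= => pp'; exists q => //.
rewrite (le_lt_trans (metric_triangle _ p' _))//.
by rewrite -(subrK r r') ltrD.
Qed.

Lemma le_near_set r r' A : r <= r' -> near_set r A `<=` near_set r' A.
Proof. by move=> rr' p [q Aq pq]; exists q => //; exact: lt_le_trans rr'. Qed.

Lemma bigcap_near_set A : \bigcap_n near_set n.+1%:R^-1 A = closure A.
Proof.
apply/seteqP; split => p.
  move=> hp U /nbhs_ballP[e /= e0 eU].
  have [n _ /(_ _ (leqnn n))/= ne] := near_infty_natSinv_lt (PosNum e0).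
  have [q Aq pq] := hp n I; exists q; split => //; apply: eU.
  by rewrite ballEmdist /=; exact: lt_trans ne.
move=> cp n _; have n0 : 0 < n.+1%:R^-1 :> R by [].
have [q [Aq]] := cp _ (nbhsx_ballx p _ n0).
by rewrite ballEmdist /= => pq; exists q.
Qed.

Lemma near_set_bounded r A : metric_bounded A -> metric_bounded (near_set r A).
Proof.
move=> [M AM]; exists (r + (M + r)) => p p' [q Aq pq] [q' Aq' pq'].
rewrite (le_trans (metric_triangle _ q _))// lerD ?(ltW pq)//.
rewrite (le_trans (metric_triangle _ q' _))// lerD ?AM// metric_sym.
exact: ltW.
Qed.

(** Points within [r] both of [A] and of its complement: a neighbourhood of the
    boundary that shrinks to it as [r] tends to 0, and that contains every [p] which
    a displacement shorter than [r] carries into or out of [A]. *)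
Definition straddle r A : set T := near_set r A `&` near_set r (~` A).

Lemma open_straddle r A : open (straddle r A).
Proof. by apply: openI; exact: open_near_set. Qed.

Lemma closure_straddle r r' A : r < r' -> closure (straddle r A) `<=` straddle r' A.
Proof.
move=> rr'; apply: (subset_trans (@closureI _ _ _)) => p [pA pA'].
by split; [exact: closure_near_set rr' _ pA|exact: closure_near_set rr' _ pA'].
Qed.

Lemma bigcap_straddle A :
  \bigcap_n straddle n.+1%:R^-1 A = closure A `\` A°.
Proof. by rewrite /straddle bigcapI !bigcap_near_set closure_setC. Qed.

Lemma mem_straddle r A (p q : T) : 0 < r -> mdist p q < r ->
  (A p /\ ~ A q) \/ (~ A p /\ A q) -> straddle r A p.
Proof.
move=> r0 pq [[Ap Aq]|[Ap Aq]]; split.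
- exact: sub_near_set.
- by exists q.
- by exists q.
- exact: sub_near_set.
Qed.

End near_sets.

Section null_boundary.
Context (R : realType) (T : ptopologicalType).
Variable m : {measure set (borel T) -> \bar R}.

Lemma open_borel (U : set T) : open U -> measurable (U : set (borel T)).
Proof. by move=> oU; exact: sub_gen_smallest. Qed.

Lemma closed_borel (C : set T) : closed C -> measurable (C : set (borel T)).
Proof.
move=> cC; rewrite -(setCK C).
by apply: (@measurableC _ (borel T)); apply: open_borel; exact: closed_openC.
Qed.

(** For [r < eta] the boundaries of the [U r] are disjoint subsets of [U eta]. If
    all of them had positive mass, the nondecreasing function [m (U r)] would jump at every
    [r], and choosing a rational in each jump would inject the interval ]0, eta[
    into the rationals. *)
Lemma null_boundary_radius (U : R -> set T) (eta : R) :
  0 < eta -> (forall r, open (U r)) ->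
  (forall r r', r < r' -> closure (U r) `<=` U r') -> (m (U eta) < +oo)%E ->
  exists r, [/\ 0 < r, r < eta & m (closure (U r) `\` (U r)°) = 0%E].
Proof.
move=> eta0 oU cU mU; apply: contrapT => noR.
pose C r : set T := closure (U r) `\` U r.
have mC r : measurable (C r : set (borel T)).
  apply: (@measurableD _ (borel T)); last exact: open_borel.
  by apply: closed_borel; exact: closed_closure.
have C0 r : 0 < r < eta -> (0 < m (C r))%E.
  move=> /andP[r0 re]; rewrite lt0e measure_ge0 andbT; apply/eqP => Cr0.
  by apply: noR; exists r; split => //; rewrite ((interior_id _).1 (oU r)).
have step r r' : r < r' -> (m (U r) + m (C r) <= m (U r'))%E.
  move=> rr'; rewrite -measureU//; first last.
  - by apply/seteqP; split => p [] // Up [].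
  - exact: open_borel.
  apply: le_measure; rewrite ?inE.
  - by apply: (@measurableU _ (borel T)) => //; exact: open_borel.
  - exact: open_borel.
  - by move=> p [/subset_closure|[]]; [exact: cU|move=> + _; exact: cU].
have fU r : r <= eta -> m (U r) \is a fin_num.
  move=> re; rewrite ge0_fin_numE ?measure_ge0//; apply: le_lt_trans mU.
  move: re; rewrite le_eqVlt => /predU1P[->//|re].
  by apply: le_trans (step _ _ re); rewrite leeDl ?measure_ge0.
have fC r : r < eta -> m (C r) \is a fin_num.
  move=> re; rewrite ge0_fin_numE ?measure_ge0//; apply: le_lt_trans mU.
  by apply: le_trans (step _ _ re); rewrite leeDr ?measure_ge0.
have /choice[q qP] r : exists q : rat, 0 < r < eta ->
    fine (m (U r)) < ratr q < fine (m (U r)) + fine (m (C r)).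
  have [re|] := boolP (0 < r < eta); last by exists 0.
  have : fine (m (U r)) < fine (m (U r)) + fine (m (C r)).
    by rewrite ltrDl fine_gt0// C0//= ltey_eq fC//; case/andP: re.
  by move=> /rat_in_itvoo[q]; rewrite in_itv/=; exists q.
have qlt r r' : 0 < r < eta -> 0 < r' < eta -> r < r' -> ratr (q r) < ratr (q r') :> R.
  move=> re re' rr'; have /andP[_ q1] := qP _ re; have /andP[q2 _] := qP _ re'.
  apply: lt_trans q1 _; apply: le_lt_trans q2.
  have /andP[_ {}re] := re; have /andP[_ {}re'] := re'.
  by rewrite -lee_fin EFinD !fineK ?fU ?fC ?(ltW re) ?(ltW re')//; exact: step.
have : countable [set` `]0, eta[].
  apply/countable_injP; exists (fun r => choice.pickle (q r)) => r r'.
  rewrite !inE/= !in_itv/= => re re' /(pcan_inj choice.pickleK) qq.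
  have [rr'|rr'|//] := ltgtP r r'.
    by have := qlt _ _ re re' rr'; rewrite qq ltxx.
  by have := qlt _ _ re' re rr'; rewrite qq ltxx.
move=> /countable_lebesgue_measure0; rewrite lebesgue_measure_itv/= lte_fin eta0.
by rewrite oppr0 adde0 => -[] /eqP; rewrite gt_eqF.
Qed.

End null_boundary.

Section straddle_measure.
Context (R : realType) (d : nat).
Local Notation T := (Dbar0 R d).
Variable m : {measure set (borel T) -> \bar R}.
Hypothesis m_bounded : forall B : set T, measurable (B : set (borel T)) ->
  metric_bounded B -> (m B < +oo)%E.

Lemma metric_bounded_sub (A B : set T) :
  A `<=` B -> metric_bounded B -> metric_bounded A.
Proof. by move=> AB [M BM]; exists M => p q /AB + /AB; exact: BM. Qed.

Lemma straddle_bounded (B : set T) (r : R) :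
  metric_bounded B -> metric_bounded (straddle r B).
Proof.
move=> /(near_set_bounded r); apply: metric_bounded_sub; exact: subIsetl.
Qed.

(** The sets [straddle r B] decrease to the boundary of [B], which is [m]-null, so
    their masses tend to 0; below any radius there is another one giving a
    continuity set. *)
Lemma straddle_small (B : set T) (e : R) : metric_bounded B ->
  m (closure B `\` B°) = 0%E -> 0 < e ->
  exists2 r : R, 0 < r & m (closure (straddle r B) `\` (straddle r B)°) = 0%E /\
    (m (straddle r B) < e%:E)%E.
Proof.
move=> bB mB e0.
have mS r : measurable (straddle r B : set (borel T)).
  by apply: open_borel; exact: open_straddle.
have fS r : (m (straddle r B) < +oo)%E by apply: m_bounded => //; exact: straddle_bounded.
have : m (straddle n.+1%:R^-1 B) @[n --> \oo] --> (0 : \bar R).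
  rewrite -mB -bigcap_straddle.
  apply: (@nonincreasing_cvg_mu _ (borel T) _ m (fun n => straddle n.+1%:R^-1 B)) => //.
    by apply: bigcap_measurableType => n _; exact: mS.
  move=> k n kn; apply/subsetPset => p [p1 p2].
  have h : n.+1%:R^-1 <= k.+1%:R^-1 :> R by rewrite lef_pV2 ?posrE// ler_nat ltnS.
  by split; [exact: le_near_set p1|exact: le_near_set p2].
move=> /fine_cvgP[_ /cvgrPdist_lt /(_ e e0)[k _ /(_ k (leqnn k))]] /=.
rewrite sub0r normrN => mk.
have {}mk : (m (straddle k.+1%:R^-1 B) < e%:E)%E.
  rewrite -[ltLHS]fineK ?ge0_fin_numE ?measure_ge0// lte_fin.
  by apply: le_lt_trans mk; exact: ler_norm.
have k0 : 0 < k.+1%:R^-1 :> R by [].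
have [r [r0 rk nr]] := null_boundary_radius k0 (fun r => open_straddle r B)
  (fun r r' rr' => closure_straddle rr') (fS _).
exists r => //; split => //; apply: le_lt_trans mk; apply: le_measure; rewrite ?inE//.
by move=> p [p1 p2]; split; apply: le_near_set (ltW rk) _ _.
Qed.

End straddle_measure.

(** * Exceedances of high levels *)

Section exceedances.
Context (R : realType) (d : nat) (disp : measure_display)
  (Omega : measurableType disp) (P : probability Omega R) (a : nat -> R).
Hypothesis a_gt0 : forall n, 0 < a n.
Hypothesis a_cvg : a @ \oo --> +oo.
Implicit Types X Y Z : Omega -> skorokhod R d.
Local Notation scaled Z n w := (skscale (a n)^-1 (Z w)).

(** Real-valued, so that the comparison of the two processes is ordinary real
    arithmetic; [scaled_countE] relates it to the products in [regularly_varying]. *)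
Definition scaled_count n (A : set Omega) : R := n%:R * fine (P A).

Lemma probability_fin (A : set Omega) : measurable A -> P A \is a fin_num.
Proof. by move=> mA; exact: fin_num_measure. Qed.

Lemma scaled_countE n (A : set Omega) : measurable A ->
  (n%:R%:E * P A)%E = (scaled_count n A)%:E.
Proof. by move=> mA; rewrite EFinM fineK ?probability_fin. Qed.

Lemma scaled_count_ge0 n A : 0 <= scaled_count n A.
Proof. by rewrite mulr_ge0// fine_ge0. Qed.

Lemma le_scaled_count n (A B : set Omega) : measurable A -> measurable B ->
  A `<=` B -> scaled_count n A <= scaled_count n B.
Proof.
move=> mA mB AB; rewrite ler_wpM2l// fine_le ?probability_fin//.
by apply: le_measure; rewrite ?inE.
Qed.

Lemma scaled_countU n (A B : set Omega) : measurable A -> measurable B ->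
  scaled_count n (A `|` B) <= scaled_count n A + scaled_count n B.
Proof.
move=> mA mB; rewrite -mulrDr ler_wpM2l// -fineD ?probability_fin// fine_le//.
- by apply: probability_fin; exact: measurableU.
- by rewrite fin_numD !probability_fin.
- exact: measureU2.
Qed.

Definition exceed Z (c : R) n : set Omega := [set w | c < supnorm (scaled Z n w)].

Lemma exceedE Z c n : exceed Z c n = [set w | c * a n < supnorm (Z w)].
Proof.
apply/funext => w; rewrite /exceed/= supnorm_skscale gtr0_norm ?invr_gt0//.
by rewrite [_^-1 * _]mulrC ltr_pdivlMr.
Qed.

Lemma measurable_exceed Z c n : process Z -> measurable (exceed Z c n).
Proof. by move=> mZ; apply: measurable_supnorm_gt; exact: process_skscale. Qed.

Definition apart X Y (e : R) n : set Omega :=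
  [set w | e < mdist (scaled X n w) (scaled Y n w)].

Lemma measurable_apart X Y e n : process X -> process Y -> measurable (apart X Y e n).
Proof. by move=> mX mY; apply: measurable_mdist_gt; exact: process_skscale. Qed.

(** The rate at which the path exceeds the level [c * a n] is at most of order [1 / n]. *)
Definition tight_exceedances Z := forall c : R, 0 < c ->
  exists M : R, \forall n \near \oo, scaled_count n (exceed Z c n) <= M.

(** The points of radius at least [c] are bounded but need not form a
    continuity set; some neighbourhood of them is one, and its finite limit bounds
    the counts. *)
Lemma regularly_varying_tight X m : regularly_varying P X a m -> tight_exceedances X.
Proof.
move=> [mX [_ [[_ mb _] Xm]]] c c0.
pose A : set (Dbar0 R d) := [set p | (c%:E <= Defs.radius p)%E].
have bA : metric_bounded A by apply/metric_bounded_Dbar0P; exists c.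
have mU r : measurable (near_set r A : set (borel (Dbar0 R d))).
  by apply: open_borel; exact: open_near_set.
have fU r : (m (near_set r A) < +oo)%E by apply: mb => //; exact: near_set_bounded.
have [r [r0 _ nr]] := null_boundary_radius ltr01 (fun r => open_near_set r A)
  (fun r r' rr' => closure_near_set rr') (fU 1).
have := Xm _ (mU r) (near_set_bounded r bA) nr.
have mUf : m (near_set r A) \is a fin_num by rewrite ge0_fin_numE ?measure_ge0.
rewrite -(fineK mUf) => /fine_cvgP[_] /cvgrPdist_lt /(_ 1 ltr01) near1.
exists (fine (m (near_set r A)) + 1).
apply: filterS near1 => n /=.
have mN : measurable [set w | paths_in (near_set r A) (scaled X n w)].
  by apply: measurable_paths_in => //; exact: process_skscale.
rewrite scaled_countE//= ltr_norml => /andP[h _].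
have : scaled_count n (exceed X c n) <=
    scaled_count n [set w | paths_in (near_set r A) (scaled X n w)].
  apply: le_scaled_count => //; first exact: measurable_exceed.
  move=> w /= cw; have w0 := lt_trans c0 cw.
  apply/paths_inP; split => //; apply: (sub_near_set r0).
  by rewrite /A/= (proj1 (polar_ptP w0)) lee_fin ltW.
by move=> /le_trans; apply; move: h; lra.
Qed.

Section comparison.
Variables X Y Z : Omega -> skorokhod R d.
Hypotheses (mX : process X) (mY : process Y) (mZ : process Z).
Hypothesis cond0 : forall eps : R, 0 < eps ->
  cond_proba P
    [set w | eps < mdist (skscale u^-1 (X w)) (skscale u^-1 (Y w))]
    [set w | u < supnorm (Z w)] @[u --> +oo] --> (0 : R).

(** The conditional hypothesis read at the levels [u = c * a n]. If the conditioning
    event is null both sides vanish, which agrees with the convention for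
    [cond_proba]. *)
Lemma conditional_count_small (c e : R) : 0 < c -> 0 < e -> forall r, 0 < r ->
  \forall n \near \oo,
    scaled_count n ([set w | e < mdist (skscale (c * a n)^-1 (X w))
                                       (skscale (c * a n)^-1 (Y w))]
                    `&` exceed Z c n) <= r * scaled_count n (exceed Z c n).
Proof.
move=> c0 e0 r r0.
have ca : (c * a n) @[n --> \oo] --> +oo.
  apply/cvgryPge => M; have /cvgryPge/(_ (M / c)) := a_cvg.
  by apply: filterS => n; rewrite ler_pdivrMr// mulrC.
have := cvg_comp _ _ ca (cond0 e0) => /cvgrPdist_le/(_ r r0).
apply: filterS => n /=; rewrite sub0r normrN => h.
rewrite /scaled_count mulrCA ler_wpM2l//.
move: h; rewrite /cond_proba -exceedE; set A := (X in X `&` _).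
have mA : measurable A by apply: measurable_mdist_gt; exact: process_skscale.
have mE : measurable (exceed Z c n) by exact: measurable_exceed.
have mAE : measurable (A `&` exceed Z c n) by exact: measurableI.
have le_AE : fine (P (A `&` exceed Z c n)) <= fine (P (exceed Z c n)).
  by rewrite fine_le ?probability_fin//; apply: le_measure; rewrite ?inE.
have : 0 <= fine (P (exceed Z c n)) by rewrite fine_ge0.
rewrite le_eqVlt => /predU1P[PE0 _|PE0].
  by rewrite -PE0 mulr0; move: le_AE; rewrite -PE0.
move=> /(le_trans (ler_norm _)); rewrite ler_pdivrMr//.
Qed.

(** A vanishing conditional probability times a bounded count. The restriction
    [c <= 1] makes scaling by [c] nonexpansive, so that a distance
    exceeding [e] at scale [a n] also exceeds [e] at scale [c * a n]. *)
Lemma apart_negligible (c e : R) : tight_exceedances Z -> 0 < c -> c <= 1 -> 0 < e ->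
  scaled_count n (apart X Y e n `&` exceed Z c n) @[n --> \oo] --> (0 : R).
Proof.
move=> tZ c0 c1 e0; apply/cvgrPdist_le => r r0.
have [M hM] := tZ c c0.
have M0 : 0 < `|M| + 1 by rewrite ltr_wpDl.
have rM : 0 < r / (`|M| + 1) by rewrite divr_gt0.
apply: filterS2 hM (conditional_count_small c0 e0 rM) => n nM ncond.
rewrite sub0r normrN ger0_norm ?scaled_count_ge0//.
apply: le_trans (le_trans _ ncond) _.
  have mE : measurable (exceed Z c n) by exact: measurable_exceed.
  apply: le_scaled_count.
  - by apply: measurableI => //; exact: measurable_apart.
  - by apply: measurableI => //; apply: measurable_mdist_gt; exact: process_skscale.
  apply: setSI => w /= /lt_le_trans; apply.
  have sc (x : skorokhod R d) : skscale (a n)^-1 x = skscale c (skscale (c * a n)^-1 x).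
    apply: path_inj; apply/funext => t /=.
    by rewrite scalerA invfM mulrA divff ?gt_eqF// mul1r.
  rewrite !sc (le_trans (mdist_skscale _ _ (ltW c0)))//.
  by rewrite (max_idPl c1) mul1r.
rewrite mulrAC ler_pdivrMr// ler_pM2l// (le_trans nM)//.
by rewrite (le_trans (ler_norm M))// lerDl.
Qed.

End comparison.

(** Above a high level of [Y], the two paths rescaled by it are within 1/2 of each
    other with conditional probability at least 1/2, and then [X] exceeds half the
    level. So the exceedances of [Y] are at most twice as likely as those of [X] at
    half the level. *)
Lemma tight_transfer X Y : process X -> process Y ->
  (forall eps : R, 0 < eps ->
    cond_proba P
      [set w | eps < mdist (skscale u^-1 (X w)) (skscale u^-1 (Y w))]
      [set w | u < supnorm (Y w)] @[u --> +oo] --> (0 : R)) ->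
  tight_exceedances X -> tight_exceedances Y.
Proof.
move=> mX mY cond0 tX c c0.
have c20 : 0 < c / 2 by rewrite divr_gt0.
have h0 : 0 < 1 / 2 :> R by rewrite divr_gt0.
have [M hM] := tX _ c20; exists (M *+ 2).
apply: filterS2 hM (conditional_count_small mX mY mY cond0 c0 h0 h0) => n nM.
set A := (X in X `&` _) => ncond.
have mA : measurable A by apply: measurable_mdist_gt; exact: process_skscale.
have mEX : measurable (exceed X (c / 2) n) by exact: measurable_exceed.
have mEY : measurable (exceed Y c n) by exact: measurable_exceed.
have mAE : measurable (A `&` exceed Y c n) by exact: measurableI.
have : scaled_count n (exceed Y c n) <=
    scaled_count n ((A `&` exceed Y c n) `|` exceed X (c / 2) n).
  apply: le_scaled_count => //; first exact: measurableU.
  move=> w Yw; have [Aw|Aw] := pselect (A w); [by left|right].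
  have ca : 0 < c * a n by rewrite mulr_gt0.
  have cai : 0 <= (c * a n)^-1 by rewrite invr_ge0 ltW.
  move: Aw Yw; rewrite !exceedE /A /= => /negP; rewrite -leNgt => /= Aw Yw.
  have := le_trans (supnorm_lipschitz _ _) Aw.
  rewrite !supnorm_skscale (ger0_norm cai) -mulrBr normrM (ger0_norm cai).
  rewrite ler_pdivrMl// ler_norml => /andP[+ _].
  by move: Yw; set x := supnorm _; set y := supnorm _; set z := c * a n; rewrite [c / 2 * _]mulrAC -/z; lra.
move=> /le_trans /(_ (scaled_countU _ mAE mEX)) h.
rewrite mulr2n; move: h ncond nM.
by set x := scaled_count _ _; set y := scaled_count _ _; set z := scaled_count _ _; lra.
Qed.

End exceedances.

(** * Comparison of the two processes *)

Section count_comparison.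
Context (R : realType) (d : nat) (disp : measure_display)
  (Omega : measurableType disp) (P : probability Omega R) (a : nat -> R).
Implicit Types X Y : Omega -> skorokhod R d.

(** Two close paths of which exactly one lies in [B]: that one has norm at
    least [c], so their polar coordinates are close too. *)
Lemma polar_straddle (B : set (Dbar0 R d)) (c r e : R) (x y : skorokhod R d) :
  0 < r -> 0 < c -> (forall p, B p -> (c%:E <= Defs.radius p)%E) ->
  (forall x y : skorokhod R d, c <= supnorm x -> mdist x y <= e ->
    0 < supnorm y /\ mdist (polar_pt x) (polar_pt y) < r) ->
  mdist x y <= e ->
  (paths_in B x /\ ~ paths_in B y) \/ (~ paths_in B x /\ paths_in B y) ->
  paths_in (straddle r B) x.
Proof.
move=> r0 c0 Bc er xy.
have supB (z : skorokhod R d) : 0 < supnorm z -> B (polar_pt z) -> c <= supnorm z.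
  by move=> z0 /Bc; rewrite (proj1 (polar_ptP z0)) lee_fin.
move=> [[/paths_inP[x0 Bx] Bny]|[Bnx /paths_inP[y0 By]]].
  have [y0 pxy] := er _ _ (supB _ x0 Bx) xy.
  apply/paths_inP; split => //; apply: (mem_straddle r0 pxy); left; split => // By.
  by apply: Bny; apply/paths_inP.
rewrite metric_sym in xy; have [x0 pxy] := er _ _ (supB _ y0 By) xy.
rewrite metric_sym in pxy.
apply/paths_inP; split => //; apply: (mem_straddle r0 pxy); right; split => // Bx.
by apply: Bnx; apply/paths_inP.
Qed.

(** The symmetric difference of the two events is covered by three others: either the
    scaled paths are apart, in which case the one lying in [B] is not small, or they
    are close and the first one straddles the boundary of [B]. *)
Lemma count_paths_in_close X Y (B : set (Dbar0 R d)) (c r e : R) n :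
  process X -> process Y -> measurable (B : set (borel (Dbar0 R d))) ->
  0 < r -> 0 < c -> (forall p, B p -> (c%:E <= Defs.radius p)%E) ->
  (forall x y : skorokhod R d, c <= supnorm x -> mdist x y <= e ->
    0 < supnorm y /\ mdist (polar_pt x) (polar_pt y) < r) ->
  `|scaled_count P n [set w | paths_in B (skscale (a n)^-1 (X w))] -
    scaled_count P n [set w | paths_in B (skscale (a n)^-1 (Y w))]| <=
  scaled_count P n [set w | paths_in (straddle r B) (skscale (a n)^-1 (X w))] +
  (scaled_count P n (apart a X Y e n `&` exceed a X (c / 2) n) +
   scaled_count P n (apart a X Y e n `&` exceed a Y (c / 2) n)).
Proof.
move=> mX mY mB r0 c0 Bc er.
set BX := [set w | paths_in B _]; set BY := [set w | paths_in B (skscale _ (Y w))].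
set SX := [set w | paths_in (straddle r B) _].
set FX := _ `&` exceed a X _ _; set FY := _ `&` exceed a Y _ _.
have mBX : measurable BX by apply: measurable_paths_in => //; exact: process_skscale.
have mBY : measurable BY by apply: measurable_paths_in => //; exact: process_skscale.
have mSX : measurable SX.
  apply: measurable_paths_in; first exact: process_skscale.
  by apply: open_borel; exact: open_straddle.
have mFX : measurable FX.
  by apply: measurableI; [exact: measurable_apart|exact: measurable_exceed].
have mFY : measurable FY.
  by apply: measurableI; [exact: measurable_apart|exact: measurable_exceed].
have mF : measurable (FX `|` FY) by exact: measurableU.
have mSF : measurable (SX `|` (FX `|` FY)) by exact: measurableU.
have exc (Z : Omega -> skorokhod R d) w :
    paths_in B (skscale (a n)^-1 (Z w)) -> exceed a Z (c / 2) n w.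
  move=> /paths_inP[z0 /Bc]; rewrite (proj1 (polar_ptP z0)) lee_fin.
  by apply: lt_le_trans; rewrite ltr_pdivrMr// ltr_pMr// ltr1n.
have cover w : (BX w /\ ~ BY w) \/ (~ BX w /\ BY w) -> (SX `|` (FX `|` FY)) w.
  move=> BXY; have [xy|xy] := leP (mdist (skscale (a n)^-1 (X w))
    (skscale (a n)^-1 (Y w))) e.
    by left; exact: (polar_straddle r0 c0 Bc er xy BXY).
  by right; case: BXY => [[/exc hx _]|[_ /exc hy]]; [left|right].
have split_count (A A' : set Omega) : measurable A -> measurable A' ->
    (forall w, A w -> ~ A' w -> (SX `|` (FX `|` FY)) w) ->
    scaled_count P n A <= scaled_count P n A' +
      (scaled_count P n SX + (scaled_count P n FX + scaled_count P n FY)).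
  move=> mA mA' AA'.
  have : scaled_count P n A <= scaled_count P n (A' `|` (SX `|` (FX `|` FY))).
    apply: le_scaled_count => //; first exact: measurableU.
    by move=> w Aw; have [A'w|A'w] := pselect (A' w); [left|right; exact: AA'].
  move=> /le_trans; apply.
  apply: le_trans (scaled_countU _ _ mA' mSF) _; rewrite lerD2l.
  apply: le_trans (scaled_countU _ _ mSX mF) _; rewrite lerD2l.
  exact: scaled_countU.
rewrite ler_norml; apply/andP; split.
  rewrite lerNl opprB lerBlDl; apply: split_count => // w BYw BXw.
  by apply: cover; right.
by rewrite lerBlDl; apply: split_count => // w BXw BYw; apply: cover; left.
Qed.

End count_comparison.

Theorem theorem3p2 (R : realType) (d : nat) (disp : measure_display)
    (Omega : measurableType disp) (P : probability Omega R)
    (X Y : Omega -> skorokhod R d) (a : nat -> R)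
    (m : {measure set (borel (Dbar0 R d)) -> \bar R})
    (hX : process X) (hY : process Y)
    (hXrv : regularly_varying P X a m)
    (hXY_Y : forall eps : R, 0 < eps ->
      cond_proba P
        [set w | eps < mdist (skscale u^-1 (X w)) (skscale u^-1 (Y w))]
        [set w | u < supnorm (Y w)] @[u --> +oo] --> (0 : R))
    (hXY_X : forall eps : R, 0 < eps ->
      cond_proba P
        [set w | eps < mdist (skscale u^-1 (X w)) (skscale u^-1 (Y w))]
        [set w | u < supnorm (X w)] @[u --> +oo] --> (0 : R)) :
  regularly_varying P Y a m.
Proof.
have [_ [ha [hm Xm]]] := hXrv; have [a0 _ aoo] := ha; have [_ mb _] := hm.
split => //; split => //; split => // B mB bB nB.
have tX := regularly_varying_tight hXrv.
have tY := tight_transfer a0 aoo hX hY hXY_Y tX.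
have mBf : m B \is a fin_num by rewrite ge0_fin_numE ?measure_ge0// mb.
have mpaths (Z : Omega -> skorokhod R d) (A : set (Dbar0 R d)) n : process Z ->
    measurable (A : set (borel (Dbar0 R d))) ->
    measurable [set w | paths_in A (skscale (a n)^-1 (Z w))].
  by move=> mZ mA; apply: measurable_paths_in => //; exact: process_skscale.
rewrite -(fineK mBf); apply/fine_cvgP; split.
  apply: nearW => n; by rewrite scaled_countE//; exact: mpaths.
apply/cvgrPdist_le => e e0.
have e40 : 0 < e / 4 by rewrite divr_gt0.
have [r r0 [nS mS]] := straddle_small mb bB nB e40.
(* c is taken at most 1 so that scaling by the level c / 2 is nonexpansive. *)
have [c [c0 c1 Bc]] : exists c : R, [/\ 0 < c, c <= 1 &
    forall p, B p -> (c%:E <= Defs.radius p)%E].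
  have [c c0 Bc] := (metric_bounded_Dbar0P B).1 bB.
  exists (Num.min c 1); split; rewrite ?lt_min ?c0 ?ltr01// ?ge_min ?lexx ?orbT//.
  by move=> p /Bc; apply: le_trans; rewrite lee_fin ge_min lexx.
have [f f0 hf] := polar_unif d c0 r0.
have c20 : 0 < c / 2 by rewrite divr_gt0.
have c21 : c / 2 <= 1 by rewrite ler_pdivrMr// mul1r (le_trans c1)// ler1n.
have mSr : measurable (straddle r B : set (borel (Dbar0 R d))).
  by apply: open_borel; exact: open_straddle.
have mSf : m (straddle r B) \is a fin_num.
  by rewrite ge0_fin_numE ?measure_ge0//; apply: lt_trans mS _; rewrite ltry.
have nearS : \forall n \near \oo, scaled_count P n
    [set w | paths_in (straddle r B) (skscale (a n)^-1 (X w))] <= e / 2.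
  have := Xm _ mSr (straddle_bounded r bB) nS.
  rewrite -(fineK mSf) => /fine_cvgP[_] /cvgrPdist_le /(_ _ e40).
  apply: filterS => n /=; rewrite scaled_countE; last exact: mpaths.
  move=> /= h.
  move: mS; rewrite -(fineK mSf) lte_fin; move: h; rewrite ler_norml => /andP[+ _].
  by set s := scaled_count _ _ _; set t := fine _; lra.
have nearB : \forall n \near \oo, `|fine (m B) - scaled_count P n
    [set w | paths_in B (skscale (a n)^-1 (X w))]| <= e / 4.
  have := Xm _ mB bB nB; rewrite -(fineK mBf) => /fine_cvgP[_] /cvgrPdist_le /(_ _ e40).
  by apply: filterS => n /=; rewrite scaled_countE//; exact: mpaths.
have e80 : 0 < e / 8 by rewrite divr_gt0.
have /cvgrPdist_le/(_ _ e80) nearX := apart_negligible a0 aoo hX hY hX hXY_X tX c20 c21 f0.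
have /cvgrPdist_le/(_ _ e80) nearY := apart_negligible a0 aoo hX hY hY hXY_Y tY c20 c21 f0.
apply: filterS2 (filterI nearS nearB) (filterI nearX nearY) => n [hS hB] [].
rewrite /= !sub0r !normrN => /(le_trans (ler_norm _)) hFX /(le_trans (ler_norm _)) hFY.
rewrite scaled_countE/=; last exact: mpaths.
have := count_paths_in_close P a n hX hY mB r0 c0 Bc hf.
move: hS hB hFX hFY.
set sS := scaled_count _ _ _; set sX := scaled_count _ _ _.
set sFX := scaled_count _ _ _; set sFY := scaled_count _ _ _.
set sY := scaled_count _ _ _ => hS hB hFX hFY hXY.
rewrite -(subrKA sX) (le_trans (ler_normD _ _))//.
by move: hS hB hFX hFY hXY; lra.
Qed.
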